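(* Let $q\in\mathbb N$, $r\in\mathbb N$, and let $\mathbf z_n=(z_i)_{i=0}^n$ be a partition of $[-1,1]$. There is a constant $\delta=\delta(q,r)>0$ (depending only on $q$ and $r$) such that for each $s\in \mathcal S_{q+r}(\mathbf z_n)\cap\Delta^q$ with $s\in C^{q-1}[-1,1]$, and any $\tilde{\mathbf z}_m\in\mathcal R_\delta(\mathbf z_n)$ (i.e. any $\delta$-remesh $\tilde{\mathbf z}_m$ of $\mathbf z_n$), there exists a spline $\tilde s\in\widetilde{\mathcal S}_{q+r}(\tilde{\mathbf z}_m)\cap\Delta^q$ satisfying \[ \|s-\tilde s\|_{L_p(\mathcal I_j)}\le c(p,q,r)\,\omega_{q+r+1}(s,\mathcal I_j)_p,\qquad 0\le j\le n, \] for all $0<p\le\infty$. Moreover, the construction of $\tilde s$ does not depend on $p$ (the same $\tilde s$ works for all $0<p\le\infty$).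
   Context: A partition $\mathbf z_n=(z_i)_{i=0}^n$ of $[-1,1]$ is a sequence $-1=z_0<z_1<\dots<z_n=1$; for the definition of $\mathcal I_j$ set $z_j:=z_0$ for $j<0$ and $z_j:=z_n$ for $j>n$, and $\mathcal I_j:=[(z_{j-1}+z_j)/2,(z_j+z_{j+1})/2]$. $\mathcal S_r(\mathbf z_n)$ is the space of piecewise polynomial functions (ppf) of degree $r$ with knots $\mathbf z_n$: $s\in\mathcal S_r(\mathbf z_n)$ if on each $(z_i,z_{i+1})$, $0\le i\le n-1$, $s$ is an algebraic polynomial of degree $\le r$. $\widetilde{\mathcal S}_r(\mathbf z_n):=\mathcal S_r(\mathbf z_n)\cap C^{r-1}[-1,1]$ (splines of minimal defect). $\delta$-remesh: a partition $\tilde{\mathbf z}_m=(\tilde z_i)_{i=0}^m$ of $[-1,1]$ is a $\delta$-remesh of $\mathbf z_n$ if, for each $0\le j\le n-1$, \[ \max\{\tilde z_{i+1}-\tilde z_i : [\tilde z_i,\tilde z_{i+1}]\cap(z_j,z_{j+1})\ne\emptyset\}\le\delta\min_{\nu=j-1,j,j+1}|z_{\nu+1}-z_\nu|, \] where in this definition only $z_{-1}:=-\infty$, $z_{n+1}:=+\infty$. $\mathcal R_\delta(\mathbf z_n)$ is the class of all $\delta$-remeshes of $\mathbf z_n$. $\Delta^q=\Delta^q[-1,1]$ is the set of $q$-monotone functions on $[-1,1]$: $f\in\Delta^q(J)$ if all divided differences $[f;t_0,\dots,t_q]$ at $q+1$ distinct points of $J$ are nonnegative. $L_p(J)$, $0<p\le\infty$: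 $\|f\|_{L_p(J)}=(\int_J|f|^p)^{1/p}$ for $p<\infty$, essential supremum for $p=\infty$. $\Delta_h^k(f,x,J)=\sum_{i=0}^k\binom ki(-1)^{k-i}f(x-kh/2+ih)$ if $x\pm kh/2\in J$, and $0$ otherwise; $\omega_k(f,t,J)_p=\sup_{0<h\le t}\|\Delta_h^k(f,\cdot,J)\|_{L_p(J)}$; $\omega_k(f,J)_p:=\omega_k(f,|J|,J)_p$ with $|J|$ the length of $J$. $c(\dots)$ denotes a positive constant depending only on the parameters in parentheses. *)

(* Defs.v *)
From HB Require Import structures.
From mathcomp Require Import all_boot all_order all_algebra.
From mathcomp Require Import all_classical all_reals all_analysis.

Set Implicit Arguments.
Unset Strict Implicit.
Unset Printing Implicit Defensive.

Import Order.TTheory GRing.Theory Num.Theory.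
Import numFieldNormedType.Exports.

Local Open Scope classical_set_scope.
Local Open Scope ring_scope.

(* A function on [-1, 1] is represented by a total function R -> R; all the
   notions below only look at its values on the interval concerned. *)

Section Partitions.
Context {R : realType}.
Implicit Types (n m : nat) (z zt : nat -> R).

(* Only the values z 0, ..., z n are used; n > 0 follows from z 0 != z n. *)
Definition is_partition n z : Prop :=
  [/\ z 0%N = -1, z n = 1 & forall i, (i < n)%N -> z i < z i.+1].

(* z_j := z_0 for j < 0 and z_j := z_n for j > n *)
Definition knot_clamp n z (j : int) : R :=
  match j with Posz k => z (minn k n) | Negz _ => z 0%N end.

(* z_j := -oo for j < 0 and z_j := +oo for j > n *)
Definition knot_inf n z (j : int) : \bar R :=
  match j with
  | Posz k => if (k <= n)%N then (z k)%:E else +oo%E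
  | Negz _ => -oo%E
  end.

Definition Iset_left n z (j : nat) : R :=
  (knot_clamp n z (j%:Z - 1) + knot_clamp n z j%:Z) / 2.

Definition Iset_right n z (j : nat) : R :=
  (knot_clamp n z j%:Z + knot_clamp n z (j%:Z + 1)) / 2.

Definition knot_gap n z (nu : int) : \bar R :=
  `|knot_inf n z (nu + 1) - knot_inf n z nu|%E.

(* "max {...} <= delta * min {...}" with the maximum over the finitely many
   (at least one) meeting subintervals spelled out. *)
Definition is_remesh (delta : R) n z m zt : Prop :=
  is_partition m zt /\
  forall j, (j < n)%N -> forall i, (i < m)%N ->
    `[zt i, zt i.+1] `&` `]z j, z j.+1[ !=set0 ->
    ((zt i.+1 - zt i)%:E <=
       delta%:E * Order.min (knot_gap n z (j%:Z - 1))
                   (Order.min (knot_gap n z j%:Z)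
                              (knot_gap n z (j%:Z + 1))))%E.

End Partitions.

Section Functions.
Context {R : realType}.
Implicit Types (f s : R -> R) (J : set R).

(* f is of class C^k on [a, b]: the derivatives of order <= k on ]a, b[
   exist and extend continuously to [a, b]. *)
Fixpoint Ck_on (a b : R) (k : nat) f : Prop :=
  {within `[a, b], continuous f} /\
  match k with
  | 0 => True
  | k'.+1 => exists2 g : R -> R,
      Ck_on a b k' g & forall x, x \in `]a, b[ -> is_derive x 1 f (g x)
  end.

Definition is_ppf (r n : nat) (z : nat -> R) s : Prop :=
  forall i, (i < n)%N ->
    exists2 P : {poly R}, (size P <= r.+1)%N &
      forall x, x \in `]z i, z i.+1[ -> s x = P.[x].

(* Only used with r >= 1, so that the truncated r.-1 is r - 1. *)
Definition is_spline (r n : nat) (z : nat -> R) s : Prop :=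
  is_ppf r n z s /\ Ck_on (-1) 1 r.-1 s.

Definition divided_difference f (q : nat) (t : 'I_q.+1 -> R) : R :=
  \sum_(i < q.+1) f (t i) / \prod_(j < q.+1 | j != i) (t i - t j).

Definition qmonotone (q : nat) J f : Prop :=
  forall t : 'I_q.+1 -> R, injective t -> (forall i, J (t i)) ->
    0 <= divided_difference f t.

(* The (quasi-)norm of L_p(J), for 0 < p <= +oo. *)
Definition Lp_norm J (p : \bar R) f : \bar R :=
  Lnorm lebesgue_measure p (EFin \o (f \_ J)).

Definition sym_difference (k : nat) (h : R) f (x : R) J : R :=
  if `[< J (x - k%:R * h / 2) /\ J (x + k%:R * h / 2) >] then
    \sum_(i < k.+1) 'C(k, i)%:R * (-1) ^+ (k - i)
                     * f (x - k%:R * h / 2 + i%:R * h)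
  else 0.

Definition modulus_smoothness (k : nat) f (t : R) J (p : \bar R) : \bar R :=
  ereal_sup [set Lp_norm J p (fun x => sym_difference k h f x J)
            | h in `]0, t]].

(* omega_k(f, J)_p for the interval J = [a, b], whose length is b - a *)
Definition modulus_smoothness_itv (k : nat) f (a b : R) (p : \bar R) : \bar R :=
  modulus_smoothness k f (b - a) `[a, b] p.

End Functions.

(* Main.v *)
(* Let P_j be the polynomial piece of s on [z_j, z_(j+1)], A_j = P_j - P_(j-1) and
   D = q + r.  Then s is P_0 plus the sum over the interior knots of A_j on the right
   of z_j, where A_j has only terms of degree at least q in x - z_j.  Each of these
   summands is replaced by a spline of degree D, with knots of the remesh within
   d_j = min (z_j - z_(j-1), z_(j+1) - z_j) / 2 of z_j, which is 0 on the left and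
   A_j on the right of this neighbourhood and keeps the q-th derivative nonnegative.
   After rescaling d_j to 1, let B be the largest coefficient of A_j and w a small
   constant.  The jump of s^(q) at z_j is smoothed by a monotone transition on a
   window of width w, on the left or on the right of z_j according to its sign; the
   terms of higher degree are reproduced by finitely many truncated powers, with an
   O(w B) effect on the q-th derivative, which a bump of that height compensates.
   This gives A_j up to a polynomial of degree less than q with coefficients O(w B).
   As A_j^(q) has a coefficient of order B, one of P_(j-1)^(q) and P_j^(q) is of order
   B on an interval of fixed length, and adding the missing polynomial there preserves
   nonnegativity.  The error is O(B), while the difference of order D + 1 of s with
   step d_j / (D + 1), centred so that only its last node exceeds z_j, is a value
   of A_j; hence the modulus of smoothness is at least a multiple of B. *)
Require Import Defs.
From HB Require Import structures.
From mathcomp Require Import all_boot all_order all_algebra.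
From mathcomp Require Import all_classical all_reals all_analysis.
From mathcomp Require Import ring lra zify.
Set Implicit Arguments.
Unset Strict Implicit.
Unset Printing Implicit Defensive.
Import Order.TTheory GRing.Theory Num.Theory.
Import numFieldNormedType.Exports.
Local Open Scope classical_set_scope.
Local Open Scope ring_scope.

(* [lra] slows down with the size of the context. *)
Tactic Notation "lra_from" ne_hyp_list(hs) := clear - hs; lra.

(** * Polynomials and their coefficients *)

Section Lagrange.
Context {F : fieldType}.
Implicit Types (P Q : {poly F}).

Definition lagrange_poly n (t : 'I_n -> F) (i : 'I_n) : {poly F} :=
  \prod_(j < n | j != i) ((t i - t j)^-1 *: ('X - (t j)%:P)).

Lemma lagrange_poly_sample n (t : 'I_n -> F) i j : injective t ->
  (lagrange_poly t i).[t j] = (i == j)%:R.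
Proof.
move=> tI; rewrite /lagrange_poly horner_prod; case: (eqVneq i j) => [<-|ij].
  rewrite big1// => k ki; rewrite !hornerE mulVf// subr_eq0.
  by apply: contra ki => /eqP/tI ->.
by rewrite (bigD1 j) 1?eq_sym//= !hornerE subrr mulr0 mul0r.
Qed.

Lemma size_prod_XsubC_neq n (t : 'I_n -> F) i :
  size (\prod_(j < n | j != i) ('X - (t j)%:P)) = n.
Proof.
rewrite -big_filter size_prod_XsubC size_filter.
have -> : count (fun j => j != i) (index_enum 'I_n) = #|predC1 i|.
  by rewrite -sum1_card -sum1_count.
by rewrite cardC1 card_ord prednK// (leq_trans _ (ltn_ord i)).
Qed.

Lemma size_lagrange_poly n (t : 'I_n -> F) i :
  (size (lagrange_poly t i) <= n)%N.
Proof.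
rewrite /lagrange_poly scaler_prod; apply: leq_trans (size_scale_leq _ _) _.
by rewrite size_prod_XsubC_neq.
Qed.

Lemma eq_poly_sample n (t : 'I_n -> F) P Q : injective t ->
  (size P <= n)%N -> (size Q <= n)%N -> (forall i, P.[t i] = Q.[t i]) -> P = Q.
Proof.
move=> tI sP sQ PQ; apply/eqP; rewrite -subr_eq0; apply/negPn/negP => PQ0.
have := max_poly_roots (rs := [seq t i | i <- enum 'I_n]) PQ0.
rewrite map_inj_uniq ?enum_uniq// size_map size_enum_ord => /(_ _ isT).
have -> : all (root (P - Q)) [seq t i | i <- enum 'I_n].
  by apply/allP => _ /mapP[i _ ->]; rewrite /root !hornerE PQ subrr.
move=> /(_ isT); rewrite ltnNge (leq_trans (size_polyD _ _))//.
by rewrite geq_max size_polyN sP sQ.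
Qed.

Lemma lagrange_interpolation n (t : 'I_n -> F) P : injective t ->
  (size P <= n)%N -> P = \sum_(i < n) P.[t i] *: lagrange_poly t i.
Proof.
move=> tI sP; apply: (eq_poly_sample tI) => //.
  apply: leq_trans (size_sum _ _ _) _; apply/bigmax_leqP => i _.
  exact: leq_trans (size_scale_leq _ _) (size_lagrange_poly _ _).
move=> j; rewrite horner_sum (bigD1 j)//= hornerZ lagrange_poly_sample// eqxx.
rewrite mulr1 big1 ?addr0// => i ij.
by rewrite hornerZ lagrange_poly_sample// (negPf ij) mulr0.
Qed.

(** The product of the linear factors is monic. The value is the weight of the node [t i] in a
    divided difference, which thus becomes the top coefficient of the interpolating polynomial. *)
Lemma lead_lagrange_poly n (t : 'I_n.+1 -> F) i :
  (lagrange_poly t i)`_n = (\prod_(j < n.+1 | j != i) (t i - t j))^-1.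
Proof.
rewrite /lagrange_poly scaler_prod coefZ -prodfV.
have /monicP : \prod_(j < n.+1 | j != i) ('X - (t j)%:P) \is monic.
  exact: monic_prod_XsubC.
by rewrite lead_coefE size_prod_XsubC_neq /= => ->; rewrite mulr1.
Qed.

End Lagrange.

(** * Bounds between the coefficients and the values of a polynomial *)

Section PolyBounds.
Context {R : realType}.
Implicit Types (P Q : {poly R}).

Definition coef_le P (B : R) := forall i, `|P`_i| <= B.

Lemma coef_leW P (B C : R) : B <= C -> coef_le P B -> coef_le P C.
Proof. by move=> BC PB i; exact: le_trans (PB i) BC. Qed.

Lemma coef_le_ge0 P (B : R) : coef_le P B -> 0 <= B.
Proof. by move=> /(_ 0%N); exact: le_trans. Qed.

Lemma coef_leZ P (a B : R) : coef_le P B -> coef_le (a *: P) (`|a| * B).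
Proof. by move=> PB i; rewrite coefZ normrM ler_wpM2l. Qed.

Lemma coef_leMX P (B : R) : coef_le P B -> coef_le (P * 'X) B.
Proof.
by move=> PB [|i]; rewrite coefMX //= normr0 (coef_le_ge0 PB).
Qed.

Lemma horner_coef_le n P (B x : R) : (size P <= n)%N -> coef_le P B ->
  `|x| <= 1 -> `|P.[x]| <= n%:R * B.
Proof.
move=> sP PB x1; rewrite (horner_coef_wide _ sP).
apply: le_trans (ler_norm_sum _ _ _) _.
rewrite -[n in n%:R]card_ord -sum1_card natr_sum mulr_suml.
apply: ler_sum => i _; rewrite mul1r normrM normrX -[leRHS]mulr1.
by apply: ler_pM => //; rewrite exprn_ile1.
Qed.

Lemma coef_le_deriv n P (B : R) : (size P <= n)%N -> coef_le P B ->
  coef_le P^`() (n%:R * B).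
Proof.
move=> sP PB i; rewrite coef_deriv -[_ *+ _]mulr_natl normrM normr_nat.
have B0 := coef_le_ge0 PB.
have [ni|ni] := leqP n i.+1.
  have [ni'|ni'] := leqP n i; last first.
    by apply: ler_pM => //; rewrite ler_nat.
  rewrite nth_default ?normr0 ?mulr0 ?mulr_ge0//.
  exact: leq_trans sP ni.
by apply: ler_pM => //; rewrite ler_nat ltnW.
Qed.

Lemma size_derivn_le P m : (size P^`(m) <= size P)%N.
Proof.
elim: m => // m IHm; rewrite derivnS; apply: leq_trans IHm.
have [->|P0] := eqVneq P^`(m) 0; first by rewrite deriv0.
by rewrite ltnW// lt_size_deriv.
Qed.

Lemma coef_le_derivn n P (B : R) m : (size P <= n)%N -> coef_le P B ->
  coef_le P^`(m) (n%:R ^+ m * B).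
Proof.
move=> sP PB; elim: m => [|m IHm]; first by rewrite mul1r.
rewrite derivnS exprS -mulrA; apply: coef_le_deriv => //.
by rewrite (leq_trans _ sP)// size_derivn_le.
Qed.

Lemma coef_le_mul_linear P (B y : R) : coef_le P B -> `|y| <= 1 ->
  coef_le (('X - y%:P) * P) (2 * B).
Proof.
move=> PB y1 i; rewrite mulrBl coefB mulrC mul_polyC coefZ.
apply: le_trans (ler_normB _ _) _; rewrite mulr2n mulrDl mul1r; apply: lerD.
  exact: coef_leMX PB i.
rewrite normrM -[leRHS]mul1r; exact: ler_pM.
Qed.

(** Each linear factor at most doubles the coefficients and each denominator contributes at most
    [1 / s]. Since [2 / s >= 1], the omitted factor does no harm in the induction. *)
Lemma coef_le_lagrange_poly n (t : 'I_n -> R) (s : R) i : 0 < s -> s <= 1 ->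
  (forall j, `|t j| <= 1) -> (forall j k, j != k -> s <= `|t j - t k|) ->
  coef_le (lagrange_poly t i) ((2 / s) ^+ n).
Proof.
move=> s0 s1 t1 ts; rewrite /lagrange_poly.
have b1 : 1 <= 2 / s by rewrite ler_pdivlMr// mul1r; lra.
suff H (r : seq 'I_n) : coef_le
    (\prod_(j <- r | j != i) ((t i - t j)^-1 *: ('X - (t j)%:P)))
    ((2 / s) ^+ size r).
  have -> : (2 / s) ^+ n = (2 / s) ^+ size (index_enum 'I_n).
    by rewrite -[index_enum _]enumT -cardE card_ord.
  exact: H.
elim: r => [|j r IHr]; first by rewrite big_nil => i'; rewrite coef1;
  case: eqP => _; rewrite ?normr1 ?normr0.
rewrite big_cons /=; case: ifPn => ji; last first.
  apply: coef_leW IHr; rewrite exprS -[leLHS]mul1r ler_wpM2r// exprn_ge0//.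
  by rewrite (le_trans _ b1).
rewrite -scalerAl exprS.
apply: (@coef_leW _ (`|(t i - t j)^-1| * (2 * (2 / s) ^+ size r))); last first.
  by apply: coef_leZ; exact: coef_le_mul_linear.
rewrite mulrA; apply: ler_wpM2r; first by rewrite exprn_ge0// (le_trans _ b1).
rewrite mulrC; apply: ler_wpM2l => //.
by rewrite normfV lef_pV2 ?posrE// ?ts 1?eq_sym// (lt_le_trans s0)// ts// eq_sym.
Qed.

(** Equidistant points whose distance [1 / (n + 1)] to 0 and 1 leaves room for an interval around
    each of them and for a window at 0. *)
Definition nodes n (i : 'I_n) : R := i.+1%:R / n.+1%:R.

Lemma nodes_inj n : injective (@nodes n).
Proof.
move=> i j /(mulIf _) H; apply/val_inj => /=; apply/eqP.
by rewrite -eqSS -(eqr_nat R) H// invr_eq0 pnatr_eq0.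
Qed.

Lemma nodes_bnd n (i : 'I_n) : n.+1%:R^-1 <= nodes i <= 1 - n.+1%:R^-1.
Proof.
rewrite /nodes; apply/andP; split.
  by rewrite -[leLHS]mul1r ler_wpM2r// ler1n.
rewrite lerBrDr -[X in _ + X]mul1r -mulrDl ler_pdivrMr// mul1r natr1 ler_nat.
by rewrite ltnS.
Qed.

(** By Lagrange interpolation; the summand 1 keeps the constant positive also for [n = 0]. *)
Lemma coef_le_nodes n : exists2 C : R, 0 < C &
  forall P (B : R), (size P <= n)%N -> 0 <= B ->
    (forall i : 'I_n, `|P.[nodes i]| <= B) -> coef_le P (C * B).
Proof.
exists (1 + \sum_(i < n) \sum_(k < n) `|(lagrange_poly (@nodes n) i)`_k|).
  by rewrite ltr_pwDl// sumr_ge0// => i _; rewrite sumr_ge0.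
move=> P B sP B0 PB k; rewrite (lagrange_interpolation (@nodes_inj n) sP).
rewrite coef_sum mulrDl mul1r; apply: (@le_trans _ _ (0 + _)); last first.
  by apply: lerD => //; exact: lexx.
rewrite add0r; apply: le_trans (ler_norm_sum _ _ _) _; rewrite mulr_suml.
apply: ler_sum => i _; rewrite coefZ normrM mulrC ler_pM//.
have [kn|nk] := ltnP k n.
  by rewrite (bigD1 (Ordinal kn))//= lerDl sumr_ge0.
by rewrite nth_default ?normr0 ?sumr_ge0// (leq_trans (size_lagrange_poly _ _)).
Qed.

(** The cofactor of [x - y] in [x^i - y^i] has at most [n] terms of modulus at most 1, and there are
    [n] coefficients. *)
Lemma horner_lipschitz n P (B x y : R) : (size P <= n)%N -> coef_le P B ->
  `|x| <= 1 -> `|y| <= 1 -> `|P.[x] - P.[y]| <= (n%:R ^+ 2 * B) * `|x - y|.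
Proof.
move=> sP PB x1 y1; have B0 := coef_le_ge0 PB.
rewrite !(horner_coef_wide _ sP) -sumrB expr2 -mulrA -mulrA.
apply: le_trans (ler_norm_sum _ _ _) _.
rewrite -[n in n%:R * _]card_ord -sum1_card natr_sum mulr_suml.
apply: ler_sum => i _; rewrite mul1r -mulrBr subrXX normrM mulrCA; apply: ler_pM => //.
rewrite normrM mulrC ler_wpM2r//; apply: le_trans (ler_norm_sum _ _ _) _.
apply: (@le_trans _ _ (\sum_(j < i) 1)).
  apply: ler_sum => j _; rewrite normrM !normrX -[leRHS]mulr1.
  by apply: ler_pM => //; rewrite exprn_ile1.
by rewrite sumr_const card_ord ler_nat ltnW.
Qed.

(* Where a polynomial attains a value comparable to its coefficients, it keeps
   doing so on an interval of fixed length, by the Lipschitz estimate. *)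
Lemma poly_large_on_interval n : exists kap : R,
  [/\ 0 < kap, kap <= 1 / 4 &
   forall P (i0 : nat), (size P <= n)%N ->
    exists u, [/\ 2 * kap <= u, u <= 1 - 2 * kap &
      forall x, `|x - u| <= kap -> kap * `|P`_i0| <= `|P.[x]|]].
Proof.
have [C C0 HC] := coef_le_nodes n.
have n0 : 0 < n.+1%:R :> R by [].
pose K : R := n.+1%:R^-1.
have K0 : 0 < K by rewrite invr_gt0.
have K1 : K <= 1 by rewrite invf_le1// ler1n.
have e0 : 0 < 4 * C * n.+1%:R ^+ 2 by rewrite !mulr_gt0// exprn_gt0.
(* With [M] the largest coefficient, the first bound keeps the interval inside [0, 1], the second
   gives [kap * M <= M / (4 * C)], and the third bounds the variation of [P] by [M / (4 * C)]. *)
pose kap := Num.min (K / 4) (Num.min (1 / (4 * C)) (1 / (4 * C * n.+1%:R ^+ 2))).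
have kap0 : 0 < kap by rewrite /kap !lt_min !divr_gt0//= ?mulr_gt0.
have kapK : kap <= K / 4 by rewrite /kap ge_min lexx.
have kapC : kap <= 1 / (4 * C) by rewrite /kap !ge_min lexx orbT.
have kapL : kap <= 1 / (4 * C * n.+1%:R ^+ 2) by rewrite /kap !ge_min lexx !orbT.
exists kap; split => //; first by lra.
move=> P i0 sP.
pose M := \big[Num.max/0]_(i < n) `|P`_i|.
have PM : coef_le P M.
  move=> i; have [ni|ni] := ltnP i n.
    exact: (le_bigmax_cond _ (fun i : 'I_n => `|P`_i|) (j := Ordinal ni)).
  rewrite nth_default ?(leq_trans sP)// normr0; exact: bigmax_ge_id.
have M0 := coef_le_ge0 PM.
have [MP|MP] := leP M 0.
  exists (1 / 2); split; [lra|lra|move=> x _].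
  have /eqP := PM i0; have -> : M = 0 by lra.
  rewrite normr_le0 => /eqP/eqP ->.
  by rewrite normr0 mulr0.
(* Otherwise all values at the nodes would be below [M / (2 * C)], and all coefficients at most
   [M / 2]. *)
have [i Pi] : exists i : 'I_n, M / (2 * C) <= `|P.[nodes i]|.
  apply: contrapT => /forallNP H.
  have : coef_le P (C * (M / (2 * C))).
    apply: HC => //; first by rewrite divr_ge0// mulr_ge0// ltW.
    by move=> i; rewrite leNgt; apply/negP => /ltW; exact: H.
  have -> : C * (M / (2 * C)) = M / 2 by field; lra.
  move=> PM2; have : M <= M / 2.
    apply: bigmax_le => [|i _]; [by lra|exact: PM2].
  by lra.
have /andP[u1 u2] := nodes_bnd i; rewrite -/K in u1 u2.
exists (nodes i); split; [lra|lra|move=> x xu].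
have x1 : `|x| <= 1 by rewrite ler_norml; move: xu; rewrite ler_norml; lra.
have u11 : `|nodes i| <= 1 :> R by rewrite ler_norml; lra.
have := horner_lipschitz (leqW sP) PM x1 u11.
have : n.+1%:R ^+ 2 * M * `|x - nodes i| <= M / (4 * C).
  apply: (@le_trans _ _ (n.+1%:R ^+ 2 * M * (1 / (4 * C * n.+1%:R ^+ 2)))).
    by apply: ler_wpM2l; [rewrite mulr_ge0 ?exprn_ge0|exact: le_trans xu kapL].
  by rewrite le_eqVlt; apply/orP; left; apply/eqP; field; apply/andP; split; lra.
have : kap * `|P`_i0| <= M / (4 * C).
  apply: (@le_trans _ _ (1 / (4 * C) * M)); first by apply: ler_pM => //; exact: ltW.
  by rewrite mulrC mulrA mulr1.
have E : M / (2 * C) = 2 * (M / (4 * C)) by field; lra.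
rewrite E in Pi.
have := ler_normB P.[x] (P.[x] - P.[nodes i]).
rewrite subKr => H1 H2 H3 H4; lra.
Qed.

End PolyBounds.

(** * Truncated power splines *)

Section MeanValue.
Context {R : realType}.
Implicit Types (f g : R -> R).

Lemma is_derive_mean_value f g (a b : R) : a <= b ->
  (forall x : R, is_derive x 1 f (g x)) ->
  exists c, [/\ a <= c, c <= b & f b - f a = g c * (b - a)].
Proof.
move=> ab dfg.
have [|c] := MVT_segment ab (fun x _ => dfg x).
  by apply: derivable_within_continuous => x _; exact: ex_derive.
by rewrite in_itv /= => /andP[ac cb] E; exists c.
Qed.

Lemma is_derive_ge0_homo f g (a b : R) : (forall x : R, is_derive x 1 f (g x)) ->
  (forall x, a <= x <= b -> 0 <= g x) -> a <= b -> f a <= f b.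
Proof.
move=> dfg g0 ab; have [c [ac cb E]] := is_derive_mean_value ab dfg.
by rewrite -subr_ge0 E mulr_ge0 ?subr_ge0// g0// ac.
Qed.

Lemma is_derive_horner (P : {poly R}) (x : R) :
  is_derive x 1 (horner P) P^`().[x].
Proof.
apply: DeriveDef; first exact: derivable_horner.
by rewrite -derive1E -derivE.
Qed.

End MeanValue.

(** * Truncated powers, their derivatives and affine changes of variable *)

Section TruncatedPowers.
Context {R : realType}.
Implicit Types (t x c : R) (l : seq (R * R)).

(** At [x = t] the value is [0^n]: evaluation from the knot on is uniform in [n], while vanishing at
    the knot requires a positive exponent. *)
Definition tpow n t x : R := if t <= x then (x - t) ^+ n else 0.

(* A pair (c, t) stands for the coefficient c of (x - t)_+^n. *)
Definition tspline n l x : R := \sum_(a <- l) a.1 * tpow n a.2 x.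

(** The polynomial with which the spline coincides to the right of all its knots. *)
Definition tspline_poly n l : {poly R} :=
  \sum_(a <- l) a.1 *: ('X - a.2%:P) ^+ n.

Definition tscale c l := [seq (c * a.1, a.2) | a <- l].

Lemma tpow_right n t x : t <= x -> tpow n t x = (x - t) ^+ n.
Proof. by rewrite /tpow => ->. Qed.

Lemma tpow_left n t x : x <= t -> tpow n.+1 t x = 0.
Proof.
by rewrite /tpow; case: ltgtP => // -> _; rewrite subrr expr0n.
Qed.

Lemma continuous_tpow n t : continuous (tpow n.+1 t).
Proof.
have -> : tpow n.+1 t = (fun x => Num.max (x - t) 0 ^+ n.+1).
  apply/funext => x; rewrite /tpow; have [tx|tx] := leP t x.
    by rewrite max_l// subr_ge0.
  by rewrite max_r ?expr0n// subr_le0 ltW.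
move=> x; apply: (@continuous_comp _ _ _ (fun y => Num.max (y - t) 0)
  (fun y => y ^+ n.+1)); last exact: exprn_continuous.
apply: (@continuous_max _ _ (fun y : R => y - t) (cst 0)).
  by apply: cvgB; [exact: cvg_id|exact: cvg_cst].
exact: cvg_cst.
Qed.

(** Off the knot the function is locally zero or a polynomial. At the knot the difference quotient
    of step [h] equals [tpow n.+1 t (h + t)], which is continuous with limit 0. *)
Lemma is_derive_tpow n t x :
  is_derive x 1 (tpow n.+2 t) (n.+2%:R * tpow n.+1 t x).
Proof.
have [xt|tx|xt] := ltgtP x t.
- rewrite tpow_left ?ltW// mulr0.
  apply: (near_eq_is_derive (f := cst 0)) => //.
  near=> y; rewrite tpow_left; first by [].
  near: y; exact: lt_le_nbhsl.
- rewrite tpow_right ?ltW//.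
  have d := is_derive_horner (('X - t%:P) ^+ n.+2) x.
  rewrite deriv_exp derivXsubC mul1r hornerMn horner_exp hornerXsubC in d.
  rewrite mulr_natl; apply: (near_eq_is_derive _ d); near=> y.
  rewrite tpow_right; first by rewrite horner_exp hornerXsubC.
  by apply: ltW; near: y; exact: lt_nbhsr.
- rewrite xt tpow_left// mulr0.
  have H : (fun h : R => h^-1 *: ((tpow n.+2 t \o shift t) (h *: (1 : R)) - tpow n.+2 t t))
      @ 0^' --> tpow n.+1 t (0 + t).
    apply: (@cvg_trans _ ((fun h : R => tpow n.+1 t (h + t)) @ 0^')).
      apply: (@near_eq_cvg _ _ 0^' _ (fun h : R => tpow n.+1 t (h + t))).
      near=> h.
      have h0 : h != 0 by near: h; exact: nbhs_dnbhs_neq.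
      rewrite /= [tpow _ t t]tpow_left// subr0 /GRing.scale /= mulr1.
      rewrite /tpow; case: ifPn => _; last by rewrite mulr0.
      rewrite addrK [_ ^+ n.+2]exprS.
      by rewrite mulrA mulVf ?mul1r.
    apply: cvg_within_filter.
    apply: (@continuous_comp _ _ _ (fun h : R => h + t) (tpow n.+1 t)).
      by apply: cvgD; [exact: cvg_id|exact: cvg_cst].
    exact: continuous_tpow.
  rewrite (_ : tpow n.+1 t (0 + t) = 0) in H; last by rewrite add0r tpow_left.
  apply: DeriveDef; first exact: cvgP H.
  by rewrite /derive; apply/cvg_lim => //; exact: H.
Unshelve. all: by end_near. Qed.

Lemma tspline_cat n l1 l2 x :
  tspline n (l1 ++ l2) x = tspline n l1 x + tspline n l2 x.
Proof. by rewrite /tspline big_cat. Qed.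

Lemma tspline_scale n c l x : tspline n (tscale c l) x = c * tspline n l x.
Proof.
rewrite /tspline big_map mulr_sumr; apply: eq_bigr => a _ /=.
by rewrite mulrA.
Qed.

Lemma tspline_poly_cat n l1 l2 :
  tspline_poly n (l1 ++ l2) = tspline_poly n l1 + tspline_poly n l2.
Proof. by rewrite /tspline_poly big_cat. Qed.

Lemma tspline_left n l x : (forall a, a \in l -> x <= a.2) ->
  tspline n.+1 l x = 0.
Proof.
move=> lx; rewrite /tspline big1_seq// => a /andP[_ al].
by rewrite tpow_left ?mulr0// lx.
Qed.

Lemma tspline_right n l x : (forall a, a \in l -> a.2 <= x) ->
  tspline n l x = (tspline_poly n l).[x].
Proof.
move=> lx; rewrite /tspline /tspline_poly horner_sum !big_seq.
apply: eq_bigr => a al; rewrite tpow_right ?lx//.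
by rewrite hornerZ horner_exp hornerXsubC.
Qed.

Lemma size_tspline_poly n l : (size (tspline_poly n l) <= n.+1)%N.
Proof.
rewrite /tspline_poly; apply: leq_trans (size_sum _ _ _) _.
apply/bigmax_leqP_seq => a _ _; apply: leq_trans (size_scale_leq _ _) _.
by rewrite size_exp_XsubC.
Qed.

Lemma continuous_tspline n l : continuous (tspline n.+1 l).
Proof.
move=> x; elim: l => [|a l IHl].
  rewrite (_ : tspline _ _ = cst 0); first exact: cvg_cst.
  by apply/funext => y; rewrite /tspline big_nil.
rewrite (_ : tspline _ _ = fun y => a.1 * tpow n.+1 a.2 y + tspline n.+1 l y).
  apply: (@continuousD _ _ _ (fun y => a.1 * tpow n.+1 a.2 y)) => //.
  by apply: continuousM; [exact: cvg_cst|exact: continuous_tpow].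
by apply/funext => y; rewrite /tspline big_cons.
Qed.

Lemma is_derive_tspline n l x :
  is_derive x 1 (tspline n.+2 l) (n.+2%:R * tspline n.+1 l x).
Proof.
elim: l => [|a l IHl].
  rewrite (_ : tspline _ _ = cst 0); last first.
    by apply/funext => y; rewrite /tspline big_nil.
  by rewrite /tspline big_nil mulr0; exact: is_derive_cst.
rewrite (_ : tspline _ _ = (a.1 \*: tpow n.+2 a.2) + tspline n.+2 l).
  have d := is_derive_tpow n a.2 x.
  by apply: is_derive_eq; rewrite /tspline big_cons mulrDr mulrCA.
by apply/funext => y; rewrite /tspline big_cons.
Qed.

Lemma tpow_affine n (u rho : R) t x : 0 < rho ->
  tpow n (u + rho * t) x = rho ^+ n * tpow n t ((x - u) / rho).
Proof.
move=> rho0; rewrite /tpow ler_pdivlMr// [t * _]mulrC -lerBrDl.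
case: ifPn => _; rewrite ?mulr0// -exprMn; congr (_ ^+ _).
by rewrite mulrBr mulrCA divff ?gt_eqF// mulr1 opprD addrA.
Qed.

Definition taffine c (u rho : R) l := [seq (c * a.1, u + rho * a.2) | a <- l].

Lemma tspline_affine n c (u rho : R) l x : 0 < rho ->
  tspline n (taffine c u rho l) x =
    c * rho ^+ n * tspline n l ((x - u) / rho).
Proof.
move=> rho0; rewrite /tspline big_map mulr_sumr; apply: eq_bigr => a _ /=.
by rewrite tpow_affine//; ring.
Qed.

(** Up to a falling factorial, a spline and its derivatives share one list of pairs and differ only
    in the exponent. A single list can thus control both the size and the q-th derivative. *)
Lemma derivn_tspline_poly m n l :
  (tspline_poly (m + n) l)^`(m) = ((m + n) ^_ m)%:R *: tspline_poly n l.
Proof.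
elim: m n => [|m IHm] n; first by rewrite ffactn0 scale1r.
rewrite derivnS addSnnS IHm derivZ ffactnSr addKn natrM -scalerA.
congr (_ *: _); rewrite /tspline_poly linear_sum scaler_sumr.
apply: eq_bigr => a _; rewrite linearZ/= deriv_exp derivXsubC mul1r.
by rewrite -scaler_nat !scalerA mulrC.
Qed.

End TruncatedPowers.

(** * Smooth transitions with knots from a fine set *)

Section FineKnots.
Context {R : realType}.
Implicit Types (K : set R) (eta a b x w : R) (l : seq (R * R)) (E : {poly R}).

(** One-sided: each point has a knot at most [eta] to its left. Near [a] this knot may lie outside
    of the interval. *)
Definition fine_on K eta a b :=
  forall x, a <= x <= b -> exists t, [/\ K t, x - eta <= t & t <= x].

Definition knots_in K a b l :=
  forall p, p \in l -> [/\ K p.2, a <= p.2 & p.2 <= b].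

Lemma fine_onW K eta a b a' b' : fine_on K eta a b -> a <= a' -> b' <= b ->
  fine_on K eta a' b'.
Proof.
move=> H aa' bb' x /andP[ax xb]; apply: H.
by rewrite (le_trans aa')//= (le_trans xb).
Qed.

Lemma knots_inW K a b a' b' l : knots_in K a b l -> a' <= a -> b <= b' ->
  knots_in K a' b' l.
Proof.
move=> H aa' bb' p /H[Kp ap pb]; split => //; first exact: le_trans ap.
exact: le_trans bb'.
Qed.

Lemma knots_in_cat K a b l1 l2 : knots_in K a b l1 -> knots_in K a b l2 ->
  knots_in K a b (l1 ++ l2).
Proof. by move=> H1 H2 p; rewrite mem_cat => /orP[/H1|/H2]. Qed.

Lemma knots_in_scale K a b c l : knots_in K a b l -> knots_in K a b (tscale c l).
Proof. by move=> H _ /mapP[p /H[Kp ap pb] ->]. Qed.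

(* The derivative of the next spline is the difference of two transitions with
   consecutive windows, which lies between 0 and 1. *)
Lemma monotone_transition n : exists2 N : R, 0 < N & forall K eta a b,
  0 < eta -> fine_on K eta a b -> N * eta <= b - a ->
  exists l, [/\ knots_in K a b l, forall x, 0 <= tspline n.+1 l x <= 1 &
    forall x, b <= x -> tspline n.+1 l x = 1].
Proof.
elim: n => [|n [N N0 IHn]].
  exists 3 => // K eta a b eta0 Kf Nab.
  (* Base case: a linear ramp. Looking from [a + eta] and from [b] yields knots inside [a, b], and
     the length [3 * eta] keeps them at least [eta] apart. *)
  have [|t0 [Kt0 at0 t0a]] := Kf (a + eta); first by apply/andP; split; lra.
  have [|t1 [Kt1 bt1 t1b]] := Kf b; first by apply/andP; split; lra.
  have t01 : 0 < t1 - t0 by lra.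
  pose c := (t1 - t0)^-1.
  have c0 : 0 < c by rewrite invr_gt0.
  have cE : c * (t1 - t0) = 1 by rewrite mulVf// gt_eqF.
  have TE x : tspline 1 [:: (c, t0); (- c, t1)] x =
      c * (tpow 1 t0 x - tpow 1 t1 x).
    by rewrite /tspline !big_cons big_nil /=; ring.
  have TB x : b <= x -> tspline 1 [:: (c, t0); (- c, t1)] x = 1.
    by move=> bx; rewrite TE !tpow_right ?expr1 -?cE; [ring|lra|lra].
  exists [:: (c, t0); (- c, t1)]; split => //.
    by move=> p; rewrite !inE => /orP[]/eqP -> /=; split => //; lra.
  move=> x; rewrite TE; have [xt0|t0x] := leP x t0.
    by rewrite !tpow_left ?subrr ?mulr0 ?ler01//; lra.
  have [xt1|t1x] := leP x t1.
    have -> : tpow 1 t0 x = x - t0 by rewrite tpow_right ?expr1 ?ltW.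
    have -> : tpow 1 t1 x = 0 by rewrite tpow_left.
    apply/andP; split; first by apply: mulr_ge0; lra.
    by rewrite -[leRHS]cE ler_pM2l//; lra.
  have -> : tpow 1 t0 x = x - t0 by rewrite tpow_right ?expr1 ?ltW.
  have -> : tpow 1 t1 x = x - t1 by rewrite tpow_right ?expr1 ?ltW.
  by rewrite (_ : x - t0 - (x - t1) = t1 - t0) ?cE ?ler01 ?lexx//; ring.
exists (2 * N) => [|K eta a b eta0 Kf Nab]; first by rewrite mulr_gt0.
have ab : 0 < b - a by rewrite (lt_le_trans _ Nab)// !mulr_gt0.
pose m := (a + b) / 2.
have [la [laK la01 la1]] : exists l, [/\ knots_in K a m l,
    forall x, 0 <= tspline n.+1 l x <= 1 &
    forall x, m <= x -> tspline n.+1 l x = 1].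
  by apply: (IHn K eta) => //; [apply: (fine_onW Kf); rewrite /m|rewrite /m]; lra.
have [lb [lbK lb01 lb1]] : exists l, [/\ knots_in K m b l,
    forall x, 0 <= tspline n.+1 l x <= 1 &
    forall x, b <= x -> tspline n.+1 l x = 1].
  by apply: (IHn K eta) => //; [apply: (fine_onW Kf); rewrite /m|rewrite /m]; lra.
pose l := la ++ tscale (-1) lb.
have lE k x : tspline k l x = tspline k la x - tspline k lb x.
  by rewrite tspline_cat tspline_scale mulN1r.
have lK : knots_in K a b l.
  apply: knots_in_cat; last apply: knots_in_scale.
    by apply: (knots_inW laK) => //; rewrite /m; lra.
  by apply: (knots_inW lbK) => //; rewrite /m; lra.
have lb0 x : x <= m -> tspline n.+1 lb x = 0.
  by move=> xm; apply: tspline_left => p /lbK[_ mp _]; exact: le_trans mp.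
have d x := is_derive_tspline n l x.
have l_ge0 x : 0 <= n.+2%:R * tspline n.+1 l x.
  rewrite mulr_ge0// lE; have [xm|mx] := leP x m.
    by rewrite lb0// subr0; have /andP[] := la01 x.
  rewrite la1; last exact: ltW.
  by rewrite subr_ge0; have /andP[] := lb01 x.
have l_homo x y : x <= y -> tspline n.+2 l x <= tspline n.+2 l y.
  by apply: (is_derive_ge0_homo d) => z _.
have l_left x : x <= a -> tspline n.+2 l x = 0.
  by move=> xa; apply: tspline_left => p /lK[_ ap _]; exact: le_trans ap.
have l_right x : b <= x -> tspline n.+2 l x = tspline n.+2 l b.
  move=> bx; have [c [bc _ E]] := is_derive_mean_value bx d.
  apply/eqP; rewrite -subr_eq0 E lE la1 ?lb1 ?subrr ?mulr0 ?mul0r//.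
  by apply: le_trans bc; rewrite /m; lra.
have l0 x : 0 <= tspline n.+2 l x.
  have [xa|ax] := leP x a; first by rewrite l_left.
  by rewrite -(l_left a (lexx a)); apply: l_homo; exact: ltW.
have l1 x : tspline n.+2 l x <= tspline n.+2 l b.
  by have [xb|bx] := leP x b; [exact: l_homo|rewrite l_right// ltW].
(* The total increase is positive, since otherwise the spline would vanish identically, whereas its
   derivative at the midpoint [m] is [n.+2]. Dividing by it makes the final value 1. *)
have lgt0 : 0 < tspline n.+2 l b.
  rewrite lt_neqAle l0 andbT eq_sym; apply/negP => /eqP l00.
  have E : tspline n.+2 l = cst 0.
    by apply/funext => x; apply/eqP; rewrite eq_le l0 -l00 l1.
  have /@derive_val := d m; rewrite E derive_cst lE lb0// la1//.
  by rewrite subr0 mulr1 => /esym/eqP; rewrite pnatr_eq0.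
exists (tscale (tspline n.+2 l b)^-1 l); split; first exact: knots_in_scale.
  move=> x; rewrite tspline_scale mulr_ge0 ?invr_ge0 ?(ltW lgt0)//=.
  by rewrite mulrC ler_pdivrMr// mul1r.
by move=> x bx; rewrite tspline_scale l_right// mulVf// gt_eqF.
Qed.

(* [x_+^i / i!] is the i-fold integral of the Heaviside function. *)
Lemma integrated_transition n i w l : 0 <= w <= 1 ->
  (forall p, p \in l -> - w <= p.2 <= w) ->
  (forall x, 0 <= tspline n.+1 l x <= 1) ->
  (forall x, w <= x -> tspline n.+1 l x = 1) ->
  forall x, `|x| <= 1 ->
  `|n.+1`!%:R / (i + n).+2`!%:R * tspline (i + n).+2 l x
      - tpow i.+1 0 x / i.+1`!%:R| <= 2 ^+ i.+1 * w.
Proof.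
move=> /andP[w0 w1] lw l01 l1.
have fact_neq0 k : k`!%:R != 0 :> R by rewrite pnatr_eq0 -lt0n fact_gt0.
have cancel (a b c t : R) : b != 0 -> c != 0 -> a / (b * c) * (b * t) = a / c * t.
  by move=> b0 c0; field; rewrite b0 c0.
(* [V i] is the i-fold integral of the transition; the factorials make each the derivative of the
   next. *)
pose V i x : R := n.+1`!%:R / (i + n).+1`!%:R * tspline (i + n).+1 l x.
have dV j x : is_derive x 1 (V j.+1) (V j x).
  have d := is_derive_tspline (j + n) l x.
  have := @is_deriveZ _ _ _ _ (n.+1`!%:R / (j + n).+2`!%:R) _ _ _ d.
  move=> d'; apply: is_derive_eq; rewrite /V /GRing.scale /= [(j + n).+2`!]factS.
  by rewrite natrM; apply: cancel; rewrite ?fact_neq0 ?pnatr_eq0.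
have dt j (x : R) : is_derive x 1 (fun y => tpow j.+2 0 y / j.+2`!%:R)
    (tpow j.+1 0 x / j.+1`!%:R).
  have d := is_derive_tpow j 0 x.
  have := @is_deriveZ _ _ _ _ (j.+2`!%:R^-1) _ _ _ d.
  rewrite (_ : _ \*: _ = (fun y => tpow j.+2 0 y / j.+2`!%:R)); last first.
    by apply/funext => y; rewrite /= mulrC.
  move=> d'; apply: is_derive_eq; rewrite /GRing.scale /= [j.+2`!]factS.
  by rewrite natrM -[X in X * _]mul1r cancel ?fact_neq0 ?pnatr_eq0// mul1r mulrC.
have Vleft j x : x <= - w -> V j x = 0.
  move=> xw; rewrite /V tspline_left ?mulr0// => p /lw/andP[wp _].
  exact: le_trans wp.
have V0 x : V 0%N x = tspline n.+1 l x by rewrite /V add0n divff ?mul1r.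
suff : forall x, `|x| <= 1 -> `|V i.+1 x - tpow i.+1 0 x / i.+1`!%:R| <= 2 ^+ i.+1 * w.
  by [].
elim: i => [|i IHi] x x1.
  rewrite expr1 (_ : 1`! = 1)%N// divr1.
  have [xw|wx] := leP x (- w).
    by rewrite Vleft// tpow_left ?subrr ?normr0 ?mulr_ge0//; lra.
  have Vx y : - w <= y -> 0 <= V 1%N y <= y + w.
    move=> wy; have [c [wc cy]] := is_derive_mean_value wy (dV 0%N).
    rewrite [V _ (- w)]Vleft// subr0 opprK => ->; rewrite V0.
    have /andP[c0 c1] := l01 c.
    rewrite mulr_ge0//=; last by lra.
    by rewrite -[leRHS]mul1r ler_wpM2r//; lra.
  rewrite ler_norml.
  have [xw'|wx'] := leP x w.
    have : 0 <= tpow 1 0 x <= w.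
      rewrite /tpow subr0 expr1; case: ifPn => x0; last by rewrite lexx.
      by rewrite x0.
    by have := Vx x (ltW wx); lra.
  rewrite tpow_right ?subr0 ?expr1; last by lra.
  have [c [wc cy E]] := is_derive_mean_value (ltW wx') (dV 0%N).
  rewrite V0 l1// mul1r in E.
  by have /andP[] : 0 <= V 1%N w <= w + w; [apply: Vx; lra|lra].
(* Both functions vanish at -1, and integrating the previous error from there over a length at most
   2 doubles the bound. *)
have d y := is_deriveB (df := V i.+1 y) (dV i.+1 y) (dt i y).
have x1' : - 1 <= x by move: x1; rewrite ler_norml => /andP[].
have [c [xc cx]] := is_derive_mean_value x1' d.
rewrite /= !fctE [V _ (- 1)]Vleft; last by lra.
rewrite [tpow _ _ (- 1)]tpow_left ?mul0r ?subr0; last by lra.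
move=> ->; rewrite normrM.
have c1 : `|c| <= 1 by rewrite ler_norml xc (le_trans cx)//; move: x1; rewrite ler_norml => /andP[].
rewrite [2 ^+ _]exprS -mulrA [leRHS]mulrC.
apply: ler_pM => //; first exact: IHi.
by move: x1; rewrite opprK !ler_norml; lra.
Qed.

End FineKnots.

(** * Splines that reproduce a given polynomial *)

Section Reproduction.
Context {R : realType}.
Implicit Types (K : set R) (eta u rho s x : R) (l : seq (R * R)) (E : {poly R}).

Lemma coef_exp_XsubC n (y : R) i : (i <= n)%N ->
  (('X - y%:P) ^+ n)`_i = (- y) ^+ (n - i) * 'C(n, i)%:R.
Proof.
move=> ni; have -> : ('X - y%:P) ^+ n =
    \poly_(i < n.+1) ((- y) ^+ (n - i) * 'C(n, i)%:R).
  rewrite poly_def addrC -polyCN exprDn; apply: eq_bigr => k _.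
  by rewrite -polyC_exp mul_polyC -scaler_nat scalerA mulrC.
by rewrite coef_poly ltnS ni.
Qed.

(* Matching coefficients, the vector c solves a Vandermonde system, whose inverse
   is given by the coefficients of the Lagrange polynomials. *)
Lemma shifted_powers_basis n s : 0 < s -> s <= 1 ->
  exists2 C : R, 0 < C & forall t : 'I_n.+1 -> R, (forall i, `|t i| <= 1) ->
  (forall i j, i != j -> s <= `|t i - t j|) ->
  forall E, (size E <= n.+1)%N -> exists c : 'I_n.+1 -> R,
    \sum_i c i *: ('X - (t i)%:P) ^+ n = E /\
    forall B, coef_le E B -> forall i, `|c i| <= C * B.
Proof.
move=> s0 s1; pose L : R := (2 / s) ^+ n.+1.
have L0 : 0 < L by rewrite exprn_gt0// divr_gt0.
exists (n.+1%:R * L) => [|t t1 ts E sE]; first by rewrite mulr_gt0.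
have tI : injective t.
  move=> i j tij; apply/eqP; apply: contraT => /ts.
  by rewrite tij subrr normr0 leNgt s0.
(* Comparing coefficients of degree [i], the moment [\sum_k c k * t k ^ (n - i)] has to be [g i]. *)
pose g (i : 'I_n.+1) : R := E`_i * ((-1) ^+ (n - i) / 'C(n, i)%:R).
exists (fun k => \sum_(i < n.+1) g i * (lagrange_poly t k)`_(n - i)).
split; last first.
  move=> B EB k; have B0 := coef_le_ge0 EB.
  apply: le_trans (ler_norm_sum _ _ _) _.
  have -> : n.+1%:R * L * B = \sum_(i < n.+1) L * B.
    by rewrite sumr_const card_ord -mulrA mulr_natl.
  apply: ler_sum => i _; rewrite normrM mulrC; apply: ler_pM => //.
    exact: coef_le_lagrange_poly.
  rewrite /g normrM -[leRHS]mulr1; apply: ler_pM => //.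
  rewrite normrM normrX normrN1 expr1n mul1r normfV normr_nat invf_le1.
    by rewrite ler1n bin_gt0 -ltnS.
  by rewrite ltr0n bin_gt0 -ltnS.
apply/polyP => i; rewrite coef_sum.
have [ni|ni] := leqP i n; last first.
  rewrite [RHS]nth_default ?(leq_trans sE)// big1// => k _.
  by rewrite coefZ nth_default ?mulr0// size_exp_XsubC.
transitivity (\sum_(j < n.+1) g j * ((-1) ^+ (n - i) * 'C(n, i)%:R) *
    ('X^(n - i) : {poly R})`_(n - j)).
  transitivity (\sum_(k < n.+1) \sum_(j < n.+1) g j * (lagrange_poly t k)`_(n - j)
    * ((- t k) ^+ (n - i) * 'C(n, i)%:R)).
    by apply: eq_bigr => k _; rewrite coefZ coef_exp_XsubC// mulr_suml.
  rewrite exchange_big /=; apply: eq_bigr => j _.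
  have sX : (size ('X^(n - i) : {poly R}) <= n.+1)%N.
    by rewrite size_polyXn ltnS leq_subr.
  rewrite [in RHS](lagrange_interpolation tI sX) coef_sum mulr_sumr.
  apply: eq_bigr => k _; rewrite coefZ hornerXn -[- t k]mulN1r exprMn.
  by ring.
rewrite (bigD1 (Ordinal (ni : (i < n.+1)%N)))//= coefXn eqxx mulr1 big1.
  rewrite addr0 /g /= -mulrA mulrACA -exprMn mulrNN mulr1 expr1n mul1r mulVf.
    by rewrite mulr1.
  by rewrite pnatr_eq0 -lt0n bin_gt0.
move=> j ji; rewrite coefXn; case: eqP => [H|]; last by rewrite mulr0.
case/eqP: ji; apply/val_inj => /=; move: H (ltn_ord j) ni.
rewrite ltnS => H jn ni; have := congr1 (subn n) H; rewrite !subKn//.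
Qed.

Lemma eq_poly_interval (P Q : {poly R}) a b : a < b ->
  (forall x, a <= x <= b -> P.[x] = Q.[x]) -> P = Q.
Proof.
move=> ab PQ; pose n := maxn (size P) (size Q).
pose t (i : 'I_n) : R := a + (b - a) * nodes i.
apply: (@eq_poly_sample _ n t); rewrite ?leq_maxl ?leq_maxr//.
  by move=> i j /addrI /(mulfI _) H; apply: nodes_inj; apply: H; lra.
move=> i; apply: PQ; have /andP[] := nodes_bnd (R := R) i.
have : 0 < n.+1%:R^-1 :> R by rewrite invr_gt0.
rewrite /t => n0 u1 u2; apply/andP; split.
  by rewrite lerDl mulr_ge0 ?subr_ge0 ?(ltW ab)// (le_trans (ltW n0) u1).
rewrite -lerBrDl ler_piMr ?subr_ge0 ?(ltW ab)//.
by rewrite (le_trans u2)// lerBlDr lerDl ltW.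
Qed.

(** The points [2 * nodes i - 1] are [2 * s] apart and as far from -1. Moving each to a knot at most
    [s] on its left keeps the knots in [-1, 1] and at least [s] apart, as [shifted_powers_basis]
    requires. *)
Lemma reproducing_spline_unit n : exists C eta : R, [/\ 0 < C, 0 < eta &
  forall K, fine_on K eta (-1) 1 -> forall E, (size E <= n.+1)%N ->
  exists l, [/\ knots_in K (-1) 1 l, tspline_poly n l = E &
    forall B k x, (k <= n)%N -> coef_le E B -> `|x| <= 1 ->
      `|tspline k l x| <= C * B]].
Proof.
pose s : R := n.+2%:R^-1.
have s0 : 0 < s by rewrite invr_gt0.
have s1 : s <= 1 by rewrite invf_le1// ler1n.
have [C C0 HC] := shifted_powers_basis n s0 s1.
exists (n.+1%:R * C * 2 ^+ n), s; split => // [|K Kf E sE].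
  by rewrite !mulr_gt0.
have nodesP (i : 'I_n.+1) : exists t, [/\ K t,
    2 * nodes i - 1 - s <= t & t <= 2 * nodes i - 1].
  by apply: Kf; have := nodes_bnd (R := R) i; rewrite -/s; lra.
have [t tP] := choice nodesP.
have t11 i : -1 <= t i <= 1.
  by have [_] := tP i; have := nodes_bnd (R := R) i; rewrite -/s; lra.
have [|i j|c [cE cB]] := HC t _ _ E sE.
- by move=> i; rewrite ler_norml.
- wlog ij : i j / (i < j)%N => [wlg|_].
    by case: (ltngtP i j) => [/wlg//|ji|/val_inj ->];
      [rewrite distrC eq_sym; exact: wlg|rewrite eqxx].
  have [_ ti1 ti2] := tP i; have [_ tj1 tj2] := tP j.
  have : nodes i + s <= nodes j :> R.
    by rewrite /nodes -/s -[X in _ + X]mul1r -mulrDl ler_pM2r// natr1 ler_nat.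
  by rewrite distrC ler_normr; lra.
exists [seq (c i, t i) | i <- enum 'I_n.+1]; split.
- move=> _ /mapP[i _ ->] /=; have [Kt _ _] := tP i.
  by have /andP[] := t11 i.
- by rewrite /tspline_poly big_map big_enum.
- move=> B k x kn EB x1; rewrite /tspline big_map big_enum /=.
  have B0 := coef_le_ge0 EB.
  apply: le_trans (ler_norm_sum _ _ _) _.
  have -> : n.+1%:R * C * 2 ^+ n * B = \sum_(i < n.+1) (C * B) * 2 ^+ n.
    by rewrite sumr_const card_ord -mulr_natl; ring.
  apply: ler_sum => i _; rewrite normrM; apply: ler_pM => //; first exact: cB.
  have xt : `|x - t i| <= 2 by have := t11 i; move: x1; rewrite !ler_norml; lra.
  rewrite /tpow; case: ifPn => _; last by rewrite normr0 exprn_ge0.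
  rewrite normrX; apply: (@le_trans _ _ (2 ^+ k)); first by rewrite lerXn2r ?nnegrE.
  by rewrite ler_weXn2l// ler1n.
Qed.

Lemma tspline_poly_affine n u rho l E : 0 < rho ->
  tspline_poly n l = E \Po (rho *: 'X + u%:P) ->
  tspline_poly n (taffine (rho ^- n) u rho l) = E.
Proof.
move=> rho0 lE; apply: (@eq_poly_interval _ _ 0 1) => // x _.
have -> : E.[x] = (tspline_poly n l).[(x - u) / rho].
  by rewrite lE horner_comp hornerD hornerZ hornerX hornerC mulrC divfK ?gt_eqF// subrK.
rewrite /tspline_poly !horner_sum big_map; apply: eq_bigr => a _ /=.
rewrite !hornerZ !horner_exp !hornerXsubC -mulrA mulrCA; congr (_ * _).
by rewrite -exprVn -exprMn; congr (_ ^+ _); field; rewrite gt_eqF.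
Qed.

Lemma size_comp_affine u rho E : 0 < rho ->
  size (E \Po (rho *: 'X + u%:P)) = size E.
Proof.
move=> rho0; rewrite size_comp_poly2// size_polyDl size_scale ?gt_eqF// size_polyX//.
by rewrite (leq_ltn_trans (size_polyC_leq1 _)).
Qed.

(** The unit case after [x = u + rho * y]. The coefficients acquire [rho^-n] and the exponent [k]
    acquires [rho^k], whence the factor [rho ^+ (n - k)]. *)
Lemma reproducing_spline n : exists C eta : R, [/\ 0 < C, 0 < eta &
  forall K u rho, 0 < rho -> fine_on K (eta * rho) (u - rho) (u + rho) ->
  forall E, (size E <= n.+1)%N ->
  exists l, [/\ knots_in K (u - rho) (u + rho) l, tspline_poly n l = E &
    forall B k x, (k <= n)%N -> coef_le (E \Po (rho *: 'X + u%:P)) B ->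
      `|x - u| <= rho -> `|tspline k l x| * rho ^+ (n - k) <= C * B]].
Proof.
have [C [eta [C0 eta0 H]]] := reproducing_spline_unit n.
exists C, eta; split => // K u rho rho0 Kf E sE.
have [||l [lK lE lB]] := H [set t | K (u + rho * t)] _ (E \Po (rho *: 'X + u%:P)).
- move=> x /andP[x1 x2]; have [|t [Kt t1 t2]] := Kf (u + rho * x).
    by apply/andP; split; nra.
  exists ((t - u) / rho); split => /=.
  + by rewrite [rho * _]mulrC divfK ?gt_eqF// addrC subrK.
  + by rewrite ler_pdivlMr//; nra.
  + by rewrite ler_pdivrMr//; nra.
- by rewrite size_comp_affine.
have knotsE p : p \in taffine (rho ^- n) u rho l ->
    [/\ K p.2, u - rho <= p.2 & p.2 <= u + rho].
  by move=> /mapP[{}p /lK[Kp p1 p2] ->] /=; split => //; nra.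
exists (taffine (rho ^- n) u rho l); split => //; first exact: tspline_poly_affine.
move=> B k x kn EB xu; rewrite tspline_affine//.
have := lB B k ((x - u) / rho) kn EB.
rewrite normrM normfV (gtr0_norm rho0) ler_pdivrMr// mul1r => /(_ xu).
apply: le_trans; rewrite !normrM normfV !normrX (gtr0_norm rho0).
rewrite mulrAC -(mulrA (rho ^- n)) -exprD subnKC// mulVf ?mul1r//.
by rewrite expf_neq0// gt_eqF.
Qed.

End Reproduction.

(** * Smoothing a single knot *)

Section LocalSpline.
Context {R : realType}.
Implicit Types (K : set R) (w x : R) (l : seq (R * R)) (P Q A E : {poly R}).

Lemma coef_le_comp_affine n E (B u rho : R) : (size E <= n)%N ->
  coef_le E B -> `|u| <= 1 -> `|rho| <= 1 ->
  coef_le (E \Po (rho *: 'X + u%:P)) (n%:R * 2 ^+ n * B).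
Proof.
move=> sE EB u1 rho1; have B0 := coef_le_ge0 EB.
have pw i : coef_le ((rho *: 'X + u%:P) ^+ i) (2 ^+ i).
  elim: i => [|i IHi]; first by move=> j; rewrite coef1; case: eqP;
    rewrite ?normr1 ?normr0.
  move=> j; rewrite exprSr exprSr mulrDr mulr_natr mulr2n coefD.
  apply: le_trans (ler_normD _ _) _; apply: lerD.
    rewrite -scalerAr coefZ normrM -[leRHS]mul1r; apply: ler_pM => //.
    exact: coef_leMX.
  by rewrite mulrC mul_polyC coefZ normrM -[leRHS]mul1r; apply: ler_pM.
rewrite comp_polyE => j.
apply: (@le_trans _ _ (\sum_(i < size E) 2 ^+ n * B)); last first.
  rewrite (_ : \sum_(i < _) _ = (size E)%:R * (2 ^+ n * B)); last first.
    by rewrite sumr_const card_ord mulr_natl.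
  by rewrite -mulrA ler_wpM2r ?ler_nat// mulr_ge0// exprn_ge0.
rewrite coef_sum; apply: le_trans (ler_norm_sum _ _ _) _.
apply: ler_sum => i _; rewrite coefZ normrM mulrC; apply: ler_pM => //.
apply: le_trans (pw i j) _; rewrite ler_weXn2l ?ler1n// (leq_trans _ sE)//.
exact: ltnW.
Qed.

Lemma coef_comp_scale E (rho : R) i : (E \Po (rho *: 'X))`_i = E`_i * rho ^+ i.
Proof.
have -> : E \Po (rho *: 'X) = \poly_(i < size E) (E`_i * rho ^+ i).
  rewrite comp_polyE poly_def; apply: eq_bigr => k _.
  by rewrite exprZn scalerA.
rewrite coef_poly; case: ltnP => // sE.
by rewrite nth_default// mul0r.
Qed.

(** First stage at a knot moved to 0, its neighbourhood rescaled to [-1, 1]. From [2 * w] on the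
    q-th derivative is that of [A], so the remaining defect has degree less than [q], and the last
    clause makes it [O(w B)]. As [C] is fixed before [w], the latter can be chosen small afterwards;
    the fineness [eta] depends on it. *)
Lemma jump_spline q0 r0 (q := q0.+1) (r := r0.+1) (D := (q0 + r0).+2) :
  exists2 C : R, 0 < C & forall w, 0 < w -> w <= 1 / 2 ->
  exists2 eta : R, 0 < eta & forall K, fine_on K eta (-1) 1 ->
  forall P A B, (size A <= D.+1)%N -> (forall i, (i < q)%N -> A`_i = 0) ->
    coef_le A B -> (forall x, -1 <= x <= 0 -> 0 <= P^`(q).[x]) ->
    (forall x, 0 <= x <= 1 -> 0 <= (P + A)^`(q).[x]) ->
  exists l, [/\ knots_in K (- (2 * w)) (2 * w) l,
    (forall x, `|x| <= 1 -> 0 <= P^`(q).[x] + (D ^_ q)%:R * tspline r l x) /\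
    (forall x, x <= - w -> 0 <= tspline r l x),
    (forall x, w <= x -> A^`(q).[x] <= (D ^_ q)%:R * tspline r l x) /\
    (forall x, 2 * w <= x -> A^`(q).[x] = (D ^_ q)%:R * tspline r l x),
    forall x, `|x| <= 1 -> `|tspline D l x| <= C * B &
    forall x, 2 * w <= x <= 1 -> `|A.[x] - tspline D l x| <= C * w * B].
Proof.
have [CA [etaA [CA0 etaA0 HA]]] := reproducing_spline (R := R) D.
have [N N0 HT] := monotone_transition (R := R) r0.
set F : R := (D ^_ q)%:R.
have DE : D = (q + r)%N by rewrite /D /q /r addSn addnS.
have qD : (q <= D)%N by rewrite DE leq_addr.
have Dq : (D - q)%N = r by rewrite DE addKn.
have Dr : (D - r)%N = q by rewrite DE addnK.
have F0 : 0 < F by rewrite ltr0n ffact_gt0.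
pose f : R := r`!%:R / D`!%:R.
have FE : F * f = 1.
  have D0 : D`!%:R != 0 :> R by rewrite pnatr_eq0 -lt0n fact_gt0.
  by rewrite mulrA -natrM -Dq ffact_fact// divff.
have F_derivn l x : F * (tspline_poly r l).[x] = (tspline_poly D l)^`(q).[x].
  by rewrite [in RHS]DE derivn_tspline_poly hornerZ -DE.
pose Q : R := 2 ^+ q.
have Q0 : 0 < Q by rewrite exprn_gt0.
pose G : R := q`!%:R.
have G1 : 1 <= G by rewrite ler1n fact_gt0.
have G0 : 0 < G by rewrite (lt_le_trans _ G1).
have GE : G = q`!%:R by [].
have closeT := @integrated_transition R r0 q0.
have left0 l x : (forall p, p \in l -> x <= p.2) ->
    tspline r l x = 0 /\ tspline D l x = 0.
  by move=> lx; split; exact: tspline_left.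
rewrite -/D -/q -/r -/f -/G -/Q in HT closeT.
pose C2 : R := D.+1%:R ^+ 2 * D.+1%:R ^+ q.
have C20 : 0 < C2 by rewrite mulr_gt0// exprn_gt0.
have C2E : C2 = D.+1%:R ^+ 2 * D.+1%:R ^+ q by [].
(* Height of the bump relative to [w * B]: [F * CA] absorbs the reproduced higher terms on the
   window, [C2] absorbs [A1^(q)] itself there. *)
pose M := F * CA + C2.
have M0 : 0 < M by rewrite addr_gt0// mulr_gt0.
have ME : M = F * CA + C2 by [].
clearbody M C2 G Q f F D q r.
exists (G * (Q + 1) + CA + D.+1%:R + M * (4 * Q)).
  by rewrite !addr_gt0 ?mulr_gt0// addr_gt0.
move=> w w0 w12.
exists (Num.min (etaA * w) (w / N)); first by rewrite lt_min mulr_gt0//= divr_gt0.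
move=> K Kf P A B sA Aq AB P0 PA0.
have B0 := coef_le_ge0 AB.
have KA : fine_on K (etaA * w) (-1) 1.
  move=> x /Kf[t [Kt t1 t2]]; exists t; split => //; apply: le_trans t1.
  by rewrite lerD2l lerN2 ge_min lexx.
have KT : fine_on K (w / N) (-1) 1.
  move=> x /Kf[t [Kt t1 t2]]; exists t; split => //; apply: le_trans t1.
  by rewrite lerD2l lerN2 ge_min lexx orbT.
have wN0 : 0 < w / N by rewrite divr_gt0.
have wNE : N * (w / N) = w by rewrite mulrC divfK// gt_eqF.
have {}HT a : - 1 <= a -> a + w <= 1 -> exists l, [/\ knots_in K a (a + w) l,
    forall x, 0 <= tspline r l x <= 1 &
    forall x, a + w <= x -> tspline r l x = 1].
  move=> a1 a2; apply: (HT K (w / N)) => //; first exact: fine_onW KT _ _.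
  by rewrite wNE; lra_from w0.
(* [b0] is the jump of the q-th derivative at 0 and [A1] collects the terms of degree above [q]. *)
pose b0 := G * A`_q.
pose A1 := A - A`_q *: 'X^q.
have A1i i : A1`_i = if (i <= q)%N then 0 else A`_i.
  rewrite /A1 coefB coefZ coefXn mulr_natr mulrb.
  by case: ltngtP => [iq|qi|->]; rewrite ?subrr// subr0// Aq.
have sA1 : (size A1 <= D.+1)%N.
  by apply/leq_sizeP => i Di; rewrite A1i; case: ifP => // _;
    rewrite nth_default// (leq_trans sA).
have A1B : coef_le A1 B by move=> i; rewrite A1i; case: ifP; rewrite ?normr0.
have AE : A^`(q) = b0%:P + A1^`(q).
  rewrite -[A in LHS](subrK (A`_q *: 'X^q)) -/A1 derivnD addrC; congr (_ + _).
  rewrite derivnZ derivnXn subnn expr0 ffactnn /b0 GE mulrC.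
  by rewrite -mul_polyC -[in LHS]polyC1 -polyCMn -polyCM.
have [|ltau [tauK tauE tauB]] := HA K 0 w w0 _ A1 sA1.
  by apply: (fine_onW KA); lra_from w0 w12.
(* Rescaling by [w] gains [w^(q+1)] on the terms of [A1], while the q-th derivative costs only
   [w^q], which leaves [O(w B)]. *)
have A1w : coef_le (A1 \Po (w *: 'X + 0%:P)) (w ^+ q.+1 * B).
  move=> i; rewrite polyC0 addr0 coef_comp_scale A1i normrM normrX (gtr0_norm w0).
  case: leqP => [_|qi]; first by rewrite normr0 mul0r mulr_ge0// exprn_ge0// ltW.
  rewrite mulrC; apply: ler_pM => //; first by rewrite exprn_ge0// ltW.
  by rewrite ler_wiXn2l ?(ltW w0)//; lra_from w0 w12.
have [lT [lTK lT01 [lT1 lTl lTr]]] : exists l, [/\ knots_in K (- w) w l,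
    forall x, 0 <= tspline r l x <= 1 &
    [/\ forall x, w <= x -> tspline r l x = 1,
      forall x, x <= 0 -> 0 <= b0 * tspline r l x &
      forall x, 0 <= x -> b0 <= b0 * tspline r l x]].
  (* An upward jump is completed on [-w, 0], a downward one only starts at 0. *)
  have /orP[b00|b00] := le_total 0 b0.
    have [||l [lK l01 l1]] := HT (- w); [lra_from w0 w12|lra_from w0 w12|].
    rewrite addNr in lK l1; exists l; split => //; first by apply: (knots_inW lK); lra_from w0.
    split => [x wx|x _|x x0]; first by rewrite l1//; lra_from w0 wx.
      by rewrite mulr_ge0//; have /andP[] := l01 x.
    by rewrite l1// mulr1.
  have [||l [lK l01 l1]] := HT 0; [lra_from w0 w12|lra_from w0 w12|].
  rewrite add0r in lK l1; exists l; split => //; first by apply: (knots_inW lK); lra_from w0.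
  split => // x x0.
    rewrite (left0 _ _ _).1 ?mulr0// => p /lK[_ p0 _]; exact: le_trans p0.
  by rewrite -[leLHS]mulr1 ler_wnM2l//; have /andP[] := l01 x.
(* The bump is the difference of transitions on [-2w, -w] and [w, 2w]; it equals 1 on [-w, w]. *)
have [||l1 [l1K l101 l11]] := HT (- (2 * w)); [lra_from w0 w12|lra_from w0 w12|].
have [||l2 [l2K l201 l21]] := HT w; [lra_from w0 w12|lra_from w0 w12|].
rewrite (_ : - (2 * w) + w = - w) in l1K l11; last by ring.
rewrite (_ : w + w = 2 * w) in l2K l21; last by ring.
(* [lT] realises the jump b0 of the q-th derivative on the side of 0 where it can
   only increase that derivative, [ltau] reproduces the higher terms of [A], and
   the last summand is a bump of height O(w B) absorbing what remains negative. *)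
pose l := tscale (b0 * f) lT ++ ltau ++ tscale (M * w * B * f) (l1 ++ tscale (-1) l2).
have lE k x : tspline k l x = b0 * f * tspline k lT x + tspline k ltau x +
    M * w * B * f * (tspline k l1 x - tspline k l2 x).
  by rewrite !(tspline_cat, tspline_scale) mulN1r addrA.
have FlE x : F * tspline r l x = b0 * tspline r lT x + F * tspline r ltau x +
    M * w * B * (tspline r l1 x - tspline r l2 x).
  have E a t : F * (a * f * t) = a * t.
    by rewrite (_ : F * (a * f * t) = a * t * (F * f)); [rewrite FE mulr1|ring].
  by rewrite lE !mulrDr !E.
have tau_small x : `|x| <= w -> `|F * tspline r ltau x| <= F * CA * w * B.
  move=> xw; rewrite normrM gtr0_norm// -!mulrA ler_pM2l// mulrA.
  have := tauB _ r x _ A1w; rewrite subr0 Dr => /(_ _ xw).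
  rewrite {1}DE leq_addl => /(_ isT); rewrite exprSr.
  rewrite (_ : CA * (w ^+ q * w * B) = CA * w * B * w ^+ q); last by ring.
  by rewrite ler_pM2r// exprn_gt0.
have tau_left x : x <= - w -> tspline r ltau x = 0 /\ tspline D ltau x = 0.
  move=> xw; apply: left0 => p /tauK[_ wp _].
  by apply: le_trans wp; rewrite sub0r.
have tau_right k x : w <= x -> tspline k ltau x = (tspline_poly k ltau).[x].
  move=> wx; apply: tspline_right => p /tauK[_ _ pw].
  by apply: le_trans wx; rewrite -[w]add0r.
have tau_derivn x : w <= x -> F * tspline r ltau x = A1^`(q).[x].
  by move=> wx; rewrite tau_right// -tauE F_derivn.
have A1_small x : 0 <= x <= w -> `|A1^`(q).[x]| <= C2 * w * B.
  move=> /andP[x0 xw].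
  have sA1q : (size A1^`(q) <= D.+1)%N by rewrite (leq_trans (size_derivn_le _ _)).
  have A1q := coef_le_derivn q sA1 A1B.
  have x1 : `|x| <= 1 by rewrite ger0_norm//; lra_from xw w12 w0 x0.
  have z1 : `|0 : R| <= 1 by rewrite normr0.
  have := horner_lipschitz sA1q A1q x1 z1.
  rewrite horner_coef0 coef_derivn addn0 A1i leqnn mul0rn !subr0 (ger0_norm x0).
  move=> H; apply: le_trans H _; rewrite C2E !mulrA.
  rewrite [leRHS]mulrAC ler_wpM2l//.
  by rewrite !mulr_ge0 ?exprn_ge0.
have lT_close x : `|x| <= 1 -> `|f * tspline D lT x - tpow q 0 x / G| <= Q * w.
  move=> x1; apply: (closeT w lT _ _ lT01 lT1 _ x1); first by lra_from w0 w12.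
  by move=> p /lTK[_ -> ->].
have l12_close x : `|x| <= 1 ->
    `|f * (tspline D l1 x - tspline D l2 x)| <= 4 * Q * w.
  move=> x1; rewrite mulrBr.
  have w2 : 0 <= 2 * w <= 1 by lra_from w0 w12.
  have H1 : `|f * tspline D l1 x - tpow q 0 x / G| <= Q * (2 * w).
    apply: (closeT (2 * w) l1 w2 _ l101 _ _ x1).
      by move=> p /l1K[_ -> p2] /=; lra_from p2 w0.
    by move=> y wy; apply: l11; lra_from wy w0.
  have H2 : `|f * tspline D l2 x - tpow q 0 x / G| <= Q * (2 * w).
    apply: (closeT (2 * w) l2 w2 _ l201 l21 _ x1).
    by move=> p /l2K[_ p1 ->]; rewrite andbT; lra_from p1 w0.
  by move: H1 H2; rewrite !ler_norml => H1 H2; lra_from H1 H2.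
have b0B : `|b0| <= G * B by rewrite normrM gtr0_norm// ler_pM2l.
have MwB4 : M * w * B * (4 * Q * w) <= M * (4 * Q) * w * B.
  rewrite (_ : _ * (4 * Q * w) = M * (4 * Q) * w * B * w); last by ring.
  by apply: ler_piMr; [rewrite !mulr_ge0// ltW|lra_from w0 w12].
have lT_left x : x <= - w -> tspline r lT x = 0.
  by move=> xw; apply: (left0 _ _ _).1 => p /lTK[_ wp _]; exact: le_trans wp.
have beta01 x : 0 <= tspline r l1 x - tspline r l2 x.
  rewrite subr_ge0; have /orP[xw|wx] := le_total x w.
    rewrite [leLHS](left0 _ _ _).1; first by have /andP[] := l101 x.
    by move=> p /l2K[_ wp _]; exact: le_trans wp.
  by rewrite l11; [have /andP[] := l201 x|lra_from wx w0].
have beta1 x : `|x| <= w -> tspline r l1 x - tspline r l2 x = 1.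
  rewrite ler_norml => /andP[wx xw]; rewrite l11//.
  rewrite [X in _ - X](left0 _ _ _).1 ?subr0// => p /l2K[_ wp _].
  exact: le_trans wp.
have b0E : b0 = G * A`_q by [].
have AxE x : A.[x] = A1.[x] + A`_q * x ^+ q.
  by rewrite /A1 hornerD hornerN hornerZ hornerXn subrK.
have lK : knots_in K (- (2 * w)) (2 * w) l.
  do 2?apply: knots_in_cat.
  - by apply: knots_in_scale; apply: (knots_inW lTK); lra_from w0.
  - by apply: (knots_inW tauK); lra_from w0.
  - apply: knots_in_scale; apply: knots_in_cat; first by apply: (knots_inW l1K); lra_from w0.
    by apply: knots_in_scale; apply: (knots_inW l2K); lra_from w0.
clear HA HT Kf KA KT lTK tauK l1K l2K left0 closeT F_derivn.
clearbody l A1 b0.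
have MwB : 0 <= M * w * B by rewrite !mulr_ge0// ltW.
have MwBE : M * w * B = F * CA * w * B + C2 * w * B by rewrite ME; ring.
have pos_left x : x <= - w -> 0 <= F * tspline r l x.
  by move=> xw; rewrite FlE lT_left// (tau_left _ xw).1 !mulr0 !add0r mulr_ge0.
have pos_right x : w <= x -> A^`(q).[x] <= F * tspline r l x.
  move=> wx; rewrite FlE lT1// tau_derivn// AE hornerD hornerC mulr1 lerDl.
  by rewrite mulr_ge0.
exists l; split.
- exact: lK.
(* Left of [-w] the added derivative is nonnegative, right of [w] it is at least [A^(q)]. In between
   the bump is 1 and pays for the higher terms, with [P^(q)] as reference for [x <= 0] and
   [(P + A)^(q)] for [x >= 0]. *)
- split => [x x1|x xw]; last by have := pos_left x xw; rewrite pmulr_rge0.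
  have /orP[xw|wx] := le_total x (- w).
    rewrite addr_ge0 ?pos_left// P0//; move: x1; rewrite ler_norml => x1; lra_from x1 xw w0.
  have /orP[wx'|xw'] := le_total w x.
    have := PA0 x; rewrite derivnD hornerD => /(_ _) H.
    apply: (@le_trans _ _ (P^`(q).[x] + A^`(q).[x])).
      by apply: H; move: x1; rewrite ler_norml => x1; lra_from x1 wx' w0.
    by rewrite lerD2l; exact: pos_right.
  have xw : `|x| <= w by rewrite ler_norml; lra_from xw' wx.
  rewrite FlE beta1// mulr1 MwBE.
  have := tau_small x xw; rewrite ler_norml => /andP[tau1 tau2].
  have Cp : 0 <= C2 * w * B by rewrite !mulr_ge0// ltW.
  have /orP[x0|x0] := le_total x 0.
    have := P0 x; have := lTl x x0; move: x1; rewrite ler_norml.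
    move=> /andP[x1 x2] bT H; have {}H : 0 <= P^`(q).[x].
      by apply: H; lra_from x1 x0.
    lra_from H bT tau1 Cp.
  have := PA0 x; rewrite derivnD hornerD AE hornerD hornerC.
  have := A1_small x; rewrite ler_norml.
  have := lTr x x0; move: x1; rewrite ler_norml => /andP[x1 x2] bT H1 H2.
  have /andP[H3 H4] := H1 ltac:(lra_from x0 xw').
  have {}H2 := H2 ltac:(lra_from x0 xw' w12).
  lra_from H2 bT tau1 H3 H4.
- split => // x wx; rewrite FlE lT1 ?tau_derivn ?AE ?hornerD ?hornerC; [|lra_from wx w0|lra_from wx w0].
  rewrite l11 ?l21; [|lra_from wx w0|lra_from wx w0].
  by rewrite subrr mulr0 addr0 mulr1.
- move=> x x1.
  have H1 : `|b0 * (f * tspline D lT x)| <= G * (Q + 1) * B.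
    rewrite normrM [leRHS]mulrAC; apply: ler_pM => //.
    have : `|tpow q 0 x / G| <= 1.
      rewrite normrM normfV (gtr0_norm G0) ler_pdivrMr// mul1r (le_trans _ G1)//.
      rewrite /tpow subr0; case: ifP; rewrite ?normr0// => x0.
      by rewrite normrX exprn_ile1.
    have := lT_close x x1; have : Q * w <= Q by rewrite ler_piMr ?(ltW Q0)//; lra_from w12.
    by rewrite !ler_norml => H1 H2 H3; lra_from H1 H2 H3.
  have H2 : `|tspline D ltau x| <= CA * B + D.+1%:R * B.
    have CB : 0 <= CA * B by rewrite mulr_ge0// ltW.
    have DB : 0 <= D.+1%:R * B by rewrite mulr_ge0.
    have /orP[xw|wx] := le_total x (- w).
      by rewrite (tau_left _ xw).2 normr0 addr_ge0.
    have /orP[wx'|xw'] := le_total w x.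
      rewrite tau_right// tauE (le_trans (horner_coef_le sA1 A1B x1))//.
      by rewrite lerDr.
    have := tauB _ D x (leqnn _) A1w; rewrite subr0 subnn expr0 mulr1.
    have xw : `|x| <= w by rewrite ler_norml; lra_from wx xw'.
    move=> /(_ xw) H; apply: le_trans H _.
    have : CA * (w ^+ q.+1 * B) <= CA * B.
      rewrite ler_pM2l// ler_piMl// exprn_ile1 ?ltW//; lra_from w0 w12.
    by move=> H; apply: le_trans H _; rewrite lerDl.
  have H3 : `|M * w * B * (f * (tspline D l1 x - tspline D l2 x))| <=
      M * (4 * Q) * w * B.
    rewrite normrM (ger0_norm MwB); apply: le_trans MwB4.
    by apply: ler_wpM2l => //; exact: l12_close.
  have : M * (4 * Q) * w * B <= M * (4 * Q) * B.
    rewrite -[leLHS]mulrA ler_pM2l ?mulr_gt0// ler_piMl//; lra_from w0 w12.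
  rewrite lE -(mulrA b0) -(mulrA (M * w * B)) => H4.
  apply: le_trans (ler_normD _ _) _.
  apply: (@le_trans _ _ (G * (Q + 1) * B + (CA * B + D.+1%:R * B)
    + M * (4 * Q) * B)).
    apply: lerD; last exact: le_trans H3 H4.
    by apply: le_trans (ler_normD _ _) _; exact: lerD.
  by rewrite !mulrDl !addrA.
- move=> x /andP[x2w x1]; have xx1 : `|x| <= 1 by rewrite ger0_norm//; lra_from x2w w0.
  (* Here the higher terms are reproduced exactly, so the error comes from the transition and the
     bump alone. *)
  have -> : A.[x] - tspline D l x = - (b0 * (f * tspline D lT x - tpow q 0 x / G)
      + M * w * B * (f * (tspline D l1 x - tspline D l2 x))).
    rewrite lE tau_right ?tauE; last by lra_from x2w w0.
    rewrite AxE tpow_right ?subr0; last by lra_from x2w w0.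
    by rewrite b0E; field; lra_from G0.
  rewrite normrN; apply: le_trans (ler_normD _ _) _.
  apply: (@le_trans _ _ (G * B * (Q * w) + M * (4 * Q) * w * B)).
    apply: lerD; rewrite normrM.
      by apply: ler_pM => //; exact: lT_close.
    rewrite (ger0_norm MwB); apply: le_trans MwB4.
    by apply: ler_wpM2l => //; exact: l12_close.
  have : 0 <= (G + CA + D.+1%:R) * (w * B).
    by rewrite mulr_ge0// ?mulr_ge0 ?addr_ge0// ltW.
  by rewrite !mulrDl mulrDr => H; lra_from H.
Qed.

(** One of the two coefficients is at least half of their difference, and [poly_large_on_interval]
    applies to that polynomial, to [P] after the reflection at 0. The sign of [u] tells the side. *)
Lemma one_side_large n : exists kap : R, [/\ 0 < kap, kap <= 1 / 4 &
  forall P Q i0, (size P <= n)%N -> (size Q <= n)%N ->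
  exists u, [/\ 2 * kap <= `|u|, `|u| <= 1 - 2 * kap & forall x, `|x - u| <= kap ->
    kap * (`|Q`_i0 - P`_i0| / 2) <= if x <= 0 then `|P.[x]| else `|Q.[x]|]].
Proof.
have [kap [kap0 kap1 H]] := poly_large_on_interval (R := R) n.
exists kap; split => // P Q i0 sP sQ.
have := ler_normB Q`_i0 P`_i0.
have [QP|PQ] := leP `|P`_i0| `|Q`_i0| => HPQ.
  have [u [u1 u2 Hu]] := H Q i0 sQ; exists u.
  have u0 : 0 <= u by lra.
  rewrite (ger0_norm u0); split => // x xu.
  have -> : (x <= 0) = false.
    by apply/negbTE; rewrite -ltNge; move: xu; rewrite ler_norml; lra.
  by apply: le_trans (Hu x xu); rewrite ler_pM2l//; lra.
have sPN : (size (P \Po - 'X)%R <= n)%N.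
  by rewrite size_comp_poly2// size_polyN size_polyX.
have [u [u1 u2 Hu]] := H (P \Po - 'X) i0 sPN; exists (- u).
have u0 : 0 <= u by lra.
rewrite normrN (ger0_norm u0); split => // x xu.
have -> : x <= 0 by move: xu; rewrite ler_norml; lra.
have := Hu (- x); rewrite horner_comp hornerN hornerX opprK.
rewrite -[- x - u]opprD normrN opprK in xu * => /(_ xu).
apply: le_trans; rewrite ler_pM2l//.
have -> : - 'X = (-1) *: 'X :> {poly R} by rewrite scaleN1r.
rewrite coef_comp_scale normrM normrX normrN1 expr1n mulr1; lra.
Qed.

(** Second stage: the defect left by [jump_spline] is removed away from the knot, where the q-th
    derivative has room. The index [i0] points to a largest coefficient of [A], whose modulus is the
    [B] of the first stage. *)
Lemma local_spline q0 r0 (q := q0.+1) (r := r0.+1) (D := (q0 + r0).+2) :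
  exists C eta : R, [/\ 0 < C, 0 < eta & forall K, fine_on K eta (-1) 1 ->
  forall P A i0, (size P <= D.+1)%N -> (size A <= D.+1)%N ->
    (forall i, (i < q)%N -> A`_i = 0) -> coef_le A `|A`_i0| ->
    (forall x, -1 <= x <= 0 -> 0 <= P^`(q).[x]) ->
    (forall x, 0 <= x <= 1 -> 0 <= (P + A)^`(q).[x]) ->
  exists l, [/\ knots_in K (-1) 1 l, tspline_poly D l = A,
    forall x, `|x| <= 1 -> 0 <= P^`(q).[x] + (D ^_ q)%:R * tspline r l x &
    forall x, `|x| <= 1 -> `|tspline D l x| <= C * `|A`_i0|]].
Proof.
have [kap [kap0 kap1 Hkap]] := one_side_large D.+1.
have [C1 C10 H1] := jump_spline q0 r0.
have [Cn Cn0 Hn] := coef_le_nodes (R := R) D.+1.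
have [CA [etaA [CA0 etaA0 HA]]] := reproducing_spline (R := R) D.
pose F : R := (D ^_ q)%:R.
have DE : D = (q + r)%N by rewrite /D /q /r addSn addnS.
have qD : (q <= D)%N by rewrite DE leq_addr.
have Dr : (D - r)%N = q by rewrite DE addnK.
have F0 : 0 < F by rewrite ltr0n ffact_gt0.
have [C5 C50 C5E] : exists2 C5 : R, 0 < C5 & D.+1%:R * 2 ^+ D.+1 = C5.
  by eexists; last reflexivity; rewrite mulr_gt0// exprn_gt0.
pose c4 := F * (CA * (C5 * (Cn * C1))).
have c40 : 0 < c4 by rewrite /c4 !mulr_gt0.
pose n1 : R := D.+2%:R^-1.
have n10 : 0 < n1 by rewrite invr_gt0.
(* The first bound puts the interval around [u] outside of [-w, w], the second puts the
   interpolation nodes beyond [2 * w], and the third keeps the correction of the q-th derivative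
   below [kap * (B / 2)]; its factor [kap ^+ q] pays for rescaling to radius [kap]. *)
pose w := Num.min (kap / 4) (Num.min (n1 / 2) (kap ^+ q * kap / 2 / c4)).
have kq0 : 0 < kap ^+ q by rewrite exprn_gt0.
have w0 : 0 < w by rewrite !lt_min !divr_gt0// mulr_gt0.
have wk : w <= kap / 4 by rewrite ge_min lexx.
have wn : w <= n1 / 2 by rewrite !ge_min lexx orbT.
have wc : c4 * w <= kap ^+ q * kap / 2.
  by rewrite mulrC -ler_pdivlMr// !ge_min lexx !orbT.
have w12 : w <= 1 / 2 by lra_from wk kap1.
have [eta1 eta10 H1w] := H1 w w0 w12.
exists (C1 + CA * (C5 * (Cn * C1)) + D.+1%:R * (Cn * C1)), (Num.min eta1 (etaA * kap)).
split => [||K Kf P A i0 sP sA Aq AB P0 PA0].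
- by rewrite !addr_gt0 ?mulr_gt0.
- by rewrite lt_min eta10 mulr_gt0.
have K1 : fine_on K eta1 (-1) 1.
  move=> x /Kf[t [Kt t1 t2]]; exists t; split => //; apply: le_trans t1.
  by rewrite lerD2l lerN2 ge_min lexx.
have KA : fine_on K (etaA * kap) (-1) 1.
  move=> x /Kf[t [Kt t1 t2]]; exists t; split => //; apply: le_trans t1.
  by rewrite lerD2l lerN2 ge_min lexx orbT.
have [B BE] : exists B, B = `|A`_i0| by eexists.
have B0 : 0 <= B by rewrite BE.
rewrite -BE in AB *.
have [l1 [l1K [l1pos l1l] [l1r l1rE] l1B l1close]] := H1w K K1 P A B sA Aq AB P0 PA0.
(* [E] has degree < q, so that it can be added by a spline [l2] whose q-th
   derivative vanishes outside of an interval where the given one is >= kap B / 2. *)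
pose E := A - tspline_poly D l1.
have l1_right k x : 2 * w <= x -> tspline k l1 x = (tspline_poly k l1).[x].
  move=> wx; apply: tspline_right => p /l1K[_ _ pw]; exact: le_trans wx.
have sE : (size E <= D.+1)%N.
  by rewrite (leq_trans (size_polyD _ _))// geq_max sA size_polyN size_tspline_poly.
have EB : coef_le E (Cn * (C1 * w * B)).
  apply: Hn => // [|i]; first by rewrite !mulr_ge0// ltW.
  have /andP[u1 u2] := nodes_bnd (R := R) i; rewrite -/n1 in u1 u2.
  rewrite hornerD hornerN -l1_right; last by lra_from wn u1.
  by apply: l1close; lra_from wn u1 u2 n10.
have Eq : E^`(q) = 0.
  apply: (@eq_poly_interval _ _ _ (2 * w) (2 * w + 1)); first by lra_from w0.
  move=> x /andP[wx _]; rewrite /E derivnB hornerD hornerN l1rE// {1}DE.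
  by rewrite derivn_tspline_poly hornerZ -DE l1_right// subrr horner0.
(* For [B != 0] the subtraction [i0 - q] below is not truncated; for [B = 0] the lower bound to be
   shown is 0. *)
have iq : B != 0 -> (q <= i0)%N.
  by move=> B0'; rewrite leqNgt; apply/negP => /Aq Ai; rewrite BE Ai normr0 eqxx in B0'.
have sPA : (size (P + A)%R <= D.+1)%N.
  by rewrite (leq_trans (size_polyD _ _))// geq_max sP sA.
have [u [u1 u2 Hu]] := Hkap P^`(q) (P + A)^`(q) (i0 - q)%N
  (leq_trans (size_derivn_le _ _) sP) (leq_trans (size_derivn_le _ _) sPA).
have {}Hu x : `|x - u| <= kap ->
    kap * (B / 2) <= P^`(q).[x] + F * tspline r l1 x.
  move=> xu; have x1 : `|x| <= 1.
    by move: xu u2; rewrite !ler_norml => xu u2; lra_from xu u2 kap0.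
  have BD : kap * (B / 2) <= kap * (`|(P + A)^`(q)`_(i0 - q) - P^`(q)`_(i0 - q)| / 2).
    rewrite ler_pM2l// ler_pM2r ?invr_gt0//.
    have [->|/iq qi] := eqVneq B 0; first by [].
    rewrite derivnD coefD [X in X - _]addrC addrK coef_derivn subnKC// -mulr_natl.
    by rewrite normrM normr_nat -BE ler_peMl// ler1n ffact_gt0.
  apply: (le_trans BD); apply: (le_trans (Hu x xu)).
  have xk : kap <= `|x|.
    have : `|u| <= `|x| + `|x - u| by rewrite -{1}(subKr x u) ler_normB.
    by move=> H; lra_from H u1 xu kap0.
  case: ifPn => [x0|]; last rewrite -ltNge => /ltW x0.
    rewrite ler0_norm// in xk.
    rewrite ger0_norm; last by apply: P0; move: x1; rewrite ler_norml => x1; lra_from x1 x0.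
    by rewrite lerDl mulr_ge0// ?(ltW F0)// l1l//; lra_from xk wk kap0.
  rewrite ger0_norm// in xk.
  rewrite ger0_norm; last by apply: PA0; move: x1; rewrite ler_norml => x1; lra_from x1 x0.
  by rewrite derivnD hornerD lerD2l l1r//; lra_from xk wk kap0.
have uk1 : -1 <= u - kap by move: u2; rewrite ler_norml => u2; lra_from u2 kap0.
have uk2 : u + kap <= 1 by move: u2; rewrite ler_norml => u2; lra_from u2 kap0.
have [l2 [l2K l2E l2B]] := HA K u kap kap0 (fine_onW KA uk1 uk2) E sE.
have l2_left k x : x <= u - kap -> tspline k.+1 l2 x = 0.
  by move=> xu; apply: tspline_left => p /l2K[_ p1 _]; exact: le_trans p1.
have l2_right k x : u + kap <= x -> tspline k l2 x = (tspline_poly k l2).[x].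
  by move=> ux; apply: tspline_right => p /l2K[_ _ p1]; exact: le_trans ux.
have l2_deriv x : u + kap <= x -> F * tspline r l2 x = 0.
  move=> ux; rewrite l2_right//.
  have := derivn_tspline_poly q r l2; rewrite -DE l2E Eq => /(congr1 (horner^~ x)).
  by rewrite hornerZ horner0.
have EC : coef_le (E \Po (kap *: 'X + u%:P)) (C5 * (Cn * (C1 * w * B))).
  rewrite -C5E; apply: coef_le_comp_affine => //; first by lra_from u2 kap0.
  by rewrite gtr0_norm//; lra_from kap1.
exists (l1 ++ l2); split.
- apply: knots_in_cat; first by apply: (knots_inW l1K); lra_from w12.
  exact: knots_inW l2K uk1 uk2.
- by rewrite tspline_poly_cat l2E /E addrC subrK.
- move=> x x1; rewrite tspline_cat mulrDr addrA.
  have /orP[xu|ux] := le_total x (u - kap); first by rewrite l2_left// mulr0 addr0 l1pos.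
  have /orP[ux'|xu'] := le_total (u + kap) x; first by rewrite l2_deriv// addr0 l1pos.
  have xu : `|x - u| <= kap by rewrite ler_norml; lra_from ux xu'.
  have rD : (r <= D)%N by rewrite DE leq_addl.
  have := l2B _ r x rD EC xu; rewrite Dr => H.
  have : `|F * tspline r l2 x| <= kap * (B / 2).
    rewrite -(ler_pM2r kq0) normrM (gtr0_norm F0) -mulrA.
    apply: (@le_trans _ _ (c4 * w * B)).
      rewrite /c4 -!mulrA ler_pM2l//; apply: (le_trans H); rewrite -!mulrA.
      by rewrite le_eqVlt; apply/orP; left; apply/eqP; ring.
    apply: (@le_trans _ _ (kap ^+ q * kap / 2 * B)); first by rewrite ler_wpM2r.
    by rewrite le_eqVlt; apply/orP; left; apply/eqP; ring.
  by have := Hu x xu; rewrite ler_norml -/F => Ha /andP[Hb _]; lra_from Ha Hb.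
- move=> x x1; rewrite tspline_cat; apply: le_trans (ler_normD _ _) _.
  rewrite -addrA mulrDl; apply: lerD; first exact: l1B.
  have wB : w * B <= B by rewrite ler_piMl//; lra_from w12.
  have t1 : CA * (C5 * (Cn * (C1 * w * B))) <= CA * (C5 * (Cn * C1)) * B.
    by rewrite -!mulrA !ler_pM2l.
  have t2 : D.+1%:R * (Cn * (C1 * w * B)) <= D.+1%:R * (Cn * C1) * B.
    by rewrite -!mulrA !ler_pM2l.
  have t10 : 0 <= CA * (C5 * (Cn * C1)) * B by rewrite !mulr_ge0// ltW.
  have t20 : 0 <= D.+1%:R * (Cn * C1) * B by rewrite !mulr_ge0// ltW.
  rewrite mulrDl.
  have /orP[xu|ux] := le_total x (u - kap).
    by rewrite [D]lock /= -lock l2_left// normr0 addr_ge0.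
  have /orP[ux'|xu'] := le_total (u + kap) x.
    rewrite l2_right// l2E; have := horner_coef_le sE EB x1 => H; lra_from H t1 t2 t10 t20.
  have xu : `|x - u| <= kap by rewrite ler_norml; lra_from ux xu'.
  by have := l2B _ D x (leqnn _) EC xu; rewrite subnn expr0 mulr1 => H; lra_from H t1 t2 t10 t20.
Qed.

End LocalSpline.

(** * q-monotone functions *)

Section GeneralizedRolle.
Context {R : realType}.
Implicit Types (F : nat -> R -> R) (s : seq R) (a b : R).

Lemma rolle_zeros (f g : R -> R) b (x : R) s :
  (forall y : R, is_derive y 1 f (g y)) -> path <%R x s -> f x = 0 ->
  (forall y, y \in s -> f y = 0 /\ y <= b) ->
  exists s', [/\ size s' = size s, path <%R x s' &
    forall y, y \in s' -> g y = 0 /\ y <= b].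
Proof.
move=> dfg; elim: s x => [|y s IHs] x /=; first by exists [::].
move=> /andP[xy ys] fx0 fs0.
have [fy0 yb] := fs0 y (mem_head _ _).
have [|s' [ss' ys' gs']] := IHs y ys fy0.
  by move=> z zs; apply: fs0; rewrite inE zs orbT.
have df z : derivable f z 1 by have := dfg z => ?; exact: ex_derive.
have [||] := @Rolle R f x y xy (fun z _ => df z).
- by apply: derivable_within_continuous => z _; exact: df.
- by rewrite fx0 fy0.
move=> c; rewrite in_itv /= => /andP[xc cy] /@derive_val dc.
have gc0 : g c = 0 by rewrite -dc; apply/esym; exact: derive_val.
exists (c :: s'); split => /=; first by rewrite ss'.
  rewrite xc /=; case: s' ys' {ss' gs'} => //= d s' /andP[yd ->].
  by rewrite (lt_trans cy yd).
move=> z; rewrite inE => /predU1P[->|/gs'//].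
by split => //; apply: le_trans yb; exact: ltW.
Qed.

Lemma generalized_rolle k F a b s :
  (forall i (x : R), (i < k)%N -> is_derive x 1 (F i) (F i.+1 x)) ->
  size s = k.+1 -> sorted <%R s ->
  (forall x, x \in s -> [/\ F 0%N x = 0, a <= x & x <= b]) ->
  exists c, [/\ a <= c, c <= b & F k c = 0].
Proof.
elim: k F s => [|k IHk] F [|x s]//= dF [ss] xs Fs.
  by have [Fx ax xb] := Fs x (mem_head _ _); exists x.
have [Fx ax xb] := Fs x (mem_head _ _).
have [|s' [ss' xs' Fs']] := @rolle_zeros (F 0%N) (F 1%N) b x s (fun y => dF 0%N y isT) xs Fx.
  by move=> y ys; have [] := Fs y; rewrite ?inE ?ys ?orbT.
apply: (IHk (fun i => F i.+1) s'); rewrite ?ss' ?ss//.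
- by move=> i y ik; exact: dF.
- by case: s' xs' {ss' Fs'} => //= y s' /andP[].
- move=> y ys; have [Fy yb] := Fs' y ys; split => //; apply: le_trans ax _.
  by move: xs'; rewrite lt_path_sortedE => /andP[/allP/(_ y ys)/ltW].
Qed.

(** The difference of [F 0] and its interpolating polynomial [L] has [q + 1] zeros, so its q-th
    derivative has one. That of [L] is the constant [q!] times the top coefficient, which is the
    divided difference. *)
Lemma divided_difference_mean_value q F a b (t : 'I_q.+1 -> R) :
  (forall i (x : R), (i < q)%N -> is_derive x 1 (F i) (F i.+1 x)) ->
  injective t -> (forall i, a <= t i <= b) ->
  exists c, [/\ a <= c, c <= b & F q c = q`!%:R * divided_difference (F 0%N) t].
Proof.
move=> dF tI tab; pose L := \sum_(i < q.+1) F 0%N (t i) *: lagrange_poly t i.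
have sL : (size L <= q.+1)%N.
  apply: leq_trans (size_sum _ _ _) _; apply/bigmax_leqP => i _.
  exact: leq_trans (size_scale_leq _ _) (size_lagrange_poly _ _).
have Lt i : L.[t i] = F 0%N (t i).
  rewrite horner_sum (bigD1 i)//= hornerZ lagrange_poly_sample// eqxx mulr1.
  rewrite big1 ?addr0// => j ji.
  by rewrite hornerZ lagrange_poly_sample// (negbTE ji) mulr0.
have Lq : L`_q = divided_difference (F 0%N) t.
  rewrite coef_sum; apply: eq_bigr => i _.
  by rewrite coefZ lead_lagrange_poly.
have Lqq x : L^`(q).[x] = q`!%:R * divided_difference (F 0%N) t.
  have -> : L^`(q) = (L^`(q)`_0)%:P.
    apply: size1_polyC; apply/leq_sizeP => j j1; rewrite coef_derivn.
    rewrite nth_default ?mul0rn// (leq_trans sL)// -[q.+1]addn1 leq_add2l//.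
  by rewrite hornerC coef_derivn addn0 Lq ffactnn mulr_natl.
pose G i x := F i x - L^`(i).[x].
pose s := sort <=%R [seq t i | i <- enum 'I_q.+1].
have [||||c [ac cb Gc]] := @generalized_rolle q G a b s.
- move=> i x iq; have d := dF i x iq; have d' := is_derive_horner L^`(i) x.
  by rewrite /G derivnS; exact: is_deriveB.
- by rewrite size_sort size_map size_enum_ord.
- by rewrite sort_lt_sorted map_inj_uniq ?enum_uniq.
- move=> x; rewrite mem_sort => /mapP[i _ ->].
  by rewrite /G derivn0 Lt subrr; have /andP[] := tab i.
by exists c; split => //; move/eqP: Gc; rewrite /G subr_eq0 Lqq => /eqP.
Qed.

End GeneralizedRolle.

(** * q-monotonicity and the sign of the q-th derivative *)

Section QMonotone.
Context {R : realType}.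
Implicit Types (P : {poly R}) (a b : R).

Lemma qmonotone_of_derive q (F : nat -> R -> R) a b :
  (forall i (x : R), (i < q)%N -> is_derive x 1 (F i) (F i.+1 x)) ->
  (forall x, a <= x <= b -> 0 <= F q x) -> qmonotone q `[a, b] (F 0%N).
Proof.
move=> dF F0 t tI tab.
have [|c [ac cb E]] := divided_difference_mean_value dF tI (a := a) (b := b).
  by move=> i; have := tab i; rewrite /= in_itv.
have : 0 <= q`!%:R * divided_difference (F 0%N) t by rewrite -E F0// ac.
by rewrite pmulr_rge0// ltr0n fact_gt0.
Qed.

(** If [P^(q)] were negative at [x], it would be so on a small interval by continuity, and points
    chosen there, strictly between [a] and [b], would have a negative divided difference. *)
Lemma qmonotone_derivn_ge0 q (f : R -> R) P a b a' b' : a < b ->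
  a' <= a -> b <= b' -> qmonotone q `[a', b'] f ->
  (forall x, a < x < b -> f x = P.[x]) ->
  forall x, a <= x <= b -> 0 <= P^`(q).[x].
Proof.
move=> ab a'a bb' qf fP x /andP[ax xb]; rewrite leNgt; apply/negP => Px.
have /(_ x) cP : continuous (horner P^`(q)).
  by move=> y; apply/differentiable_continuous/derivable1_diffP/derivable_horner.
have [e /= e0 xe] : exists2 e : R, 0 < e & forall y, `|x - y| < e -> P^`(q).[y] < 0.
  have /cP := lt_nbhsl Px.
  by move=> [e /= e0 He]; exists e => // y /He.
pose a1 := Num.max a (x - e / 2); pose b1 := Num.min b (x + e / 2).
have ab1 : a1 < b1.
  by rewrite /a1 /b1 lt_min !gt_max ab/=; apply/and3P; split; lra.
have a1a : a <= a1 by rewrite /a1 le_max lexx.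
have a1x : x - e / 2 <= a1 by rewrite /a1 le_max lexx orbT.
have b1b : b1 <= b by rewrite /b1 ge_min lexx.
have b1x : b1 <= x + e / 2 by rewrite /b1 ge_min lexx orbT.
pose t (i : 'I_q.+1) : R := a1 + (b1 - a1) * nodes i.
have t_itv i : a1 < t i < b1.
  have := nodes_bnd (R := R) i; have n0 : 0 < q.+2%:R^-1 :> R by rewrite invr_gt0.
  rewrite /t => /andP[n1 n2]; apply/andP; split.
    by rewrite ltrDl mulr_gt0 ?subr_gt0// (lt_le_trans n0 n1).
  by rewrite -ltrBrDl gtr_pMr ?subr_gt0// (le_lt_trans n2)// ltrBlDr ltrDl.
have tI : injective t.
  by move=> i j /addrI /(mulfI _) H; apply: nodes_inj; apply: H; lra.
have dP i (y : R) : (i < q)%N ->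
    is_derive y 1 (horner P^`(i)) P^`(i.+1).[y].
  by move=> _; rewrite derivnS; exact: is_derive_horner.
have [|c [ac cb E]] := @divided_difference_mean_value _ q
    (fun i => horner P^`(i)) a1 b1 t dP tI.
  by move=> i; have /andP[/ltW -> /ltW ->] := t_itv i.
have : 0 <= divided_difference f t.
  by apply: qf => // i; rewrite /= in_itv /=; have /andP[] := t_itv i; lra.
have -> : divided_difference f t = divided_difference (horner P^`(0)) t.
  apply: eq_bigr => i _; rewrite derivn0 fP//.
  by have /andP[] := t_itv i; lra.
have := xe c; rewrite E => /(_ _) H.
have : q`!%:R * divided_difference (horner P^`(0)) t < 0.
  by apply: H; rewrite ltr_norml; lra.
by rewrite pmulr_rlt0 ?ltr0n ?fact_gt0// => /lt_geF ->.
Qed.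

End QMonotone.

(** * L_p norms and moduli of smoothness *)

Section LpNorm.
Context {R : realType}.
Implicit Types (J : set R) (f : R -> R) (p : \bar R) (M a b : R).
Local Notation mu := (@lebesgue_measure R).

(* The L_p-norm of the indicator function of an interval of length [d]. *)
Definition Lp_scale p (d : R) : R := if p is r%:E%E then d `^ r^-1 else 1.

Lemma Lp_scale_gt0 p (d : R) : 0 < d -> 0 < Lp_scale p d.
Proof. by case: p => //= r d0; exact: powR_gt0. Qed.

Lemma Lp_scaleM p (d e : R) : 0 <= d -> 0 <= e ->
  Lp_scale p (d * e) = Lp_scale p d * Lp_scale p e.
Proof. by case: p => [r d0 e0||] /=; rewrite ?mulr1// powRM. Qed.

(** The integral of a nonnegative function is the supremum over the simple functions below it, and a
    larger function admits more of them. *)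
Lemma ge0_le_integralT (f g : R -> \bar R) : (forall x, 0 <= f x)%E ->
  (forall x, f x <= g x)%E -> (\int[mu]_x f x <= \int[mu]_x g x)%E.
Proof.
move=> f0 fg; rewrite !ge0_integralTE//; last by move=> x; exact: le_trans (fg x).
apply: le_ereal_sup => _ [h hf <-]; exists h => //= x.
exact: le_trans (hf x) (fg x).
Qed.

Lemma integral_cst_itv (c a b : R) : a <= b -> 0 <= c ->
  (\int[mu]_x ((cst c%:E) \_ `[a, b]) x)%E = (c * (b - a))%:E.
Proof.
move=> ab c0; rewrite -integral_mkcond integral_cst//= lebesgue_measure_itv/=.
rewrite lte_fin; case: ltP => [_|ba]; first by rewrite EFinM EFinB.
have -> : a = b by apply/eqP; rewrite eq_le ab.
by rewrite subrr mule0 mulr0.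
Qed.

Lemma Lp_norm_le J p f M a b : (0 < p)%E -> 0 <= M -> a <= b ->
  (forall x, J x -> `|f x| <= M) ->
  (forall x, J x -> ~~ (a <= x <= b) -> f x = 0) ->
  (Lp_norm J p f <= (M * Lp_scale p (b - a))%:E)%E.
Proof.
move=> p0 M0 ab fM f0.
have fJ x : `|(f \_ J) x| <= if a <= x <= b then M else 0.
  rewrite patchE; case: ifPn => [|_]; last by rewrite normr0; case: ifP.
  by rewrite inE => Jx; case: ifPn => xab; [exact: fM|rewrite f0// normr0].
rewrite /Lp_norm unlock; case: p p0 => [r| |]//=; last first.
  move=> _; case: ifP => _; last by rewrite lee_fin mulr1.
  apply/ess_sup_inf.ess_supP; apply/nearW => x /=; rewrite lee_fin mulr1.
  by apply: le_trans (fJ x) _; case: ifP.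
rewrite lte_fin => r0.
apply: (@le_trans _ _ ((M `^ r * (b - a))%:E `^ r^-1)%E); last first.
  rewrite poweR_EFin lee_fin powRM ?powR_ge0 ?subr_ge0//.
  by rewrite -powRrM divff ?gt_eqF// powRr1.
apply: gt0_ler_poweR.
- by rewrite invr_ge0 ltW.
- by rewrite in_itv/= leey andbT integral_ge0.
- by rewrite in_itv/= leey andbT lee_fin mulr_ge0 ?powR_ge0// subr_ge0.
rewrite -integral_cst_itv ?powR_ge0//; apply: ge0_le_integralT => x.
  by rewrite /= lee_fin powR_ge0.
rewrite /= [in X in (_ <= X)%E]patchE mem_setE in_itv /=.
have := fJ x; case: ifP => _ H; rewrite lee_fin.
  by apply: ge0_ler_powR => //; rewrite ?nnegrE// ltW.
have -> : `|(f \_ J) x| = 0 by apply/eqP; rewrite eq_le H normr_ge0.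
by rewrite powR0// gt_eqF.
Qed.

Lemma Lp_norm_ge J p f M a b : (0 < p)%E -> 0 <= M -> a < b ->
  (forall x, a <= x <= b -> J x /\ M <= `|f x|) ->
  ((M * Lp_scale p (b - a))%:E <= Lp_norm J p f)%E.
Proof.
move=> p0 M0 ab fM.
have fJ x : a <= x <= b -> M <= `|(f \_ J) x|.
  by move=> /fM[Jx Mf]; rewrite patchE ifT// inE.
rewrite /Lp_norm unlock; case: p p0 => [r| |]//=; last first.
  move=> _; rewrite ifT; last first.
    apply: (@lt_le_trans _ _ (mu `[a, b])); last by apply: le_measure; rewrite ?inE.
    by rewrite lebesgue_measure_itv/= lte_fin ab lte_fin subr_gt0.
  (* An essential supremum below [M] would put [a, b] into a null set. *)
  rewrite mulr1 leNgt; apply/negP => H.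
  have := @ess_sup_inf.ess_sup_ge _ _ _ mu (abse \o (EFin \o (f \_ J))).
  move=> [N [mN N0 HN]].
  have : (mu `[a, b] <= mu N)%E.
    apply: le_measure; rewrite ?inE// => x /=; rewrite in_itv /= => xab.
    apply: HN => /= Hx; have := le_lt_trans Hx H.
    by rewrite lte_fin ltNge fJ.
  rewrite N0 lebesgue_measure_itv/= lte_fin ab -EFinB lee_fin.
  by rewrite leNgt subr_gt0 ab.
rewrite lte_fin => r0.
apply: (@le_trans _ _ ((M `^ r * (b - a))%:E `^ r^-1)%E).
  rewrite poweR_EFin lee_fin powRM ?powR_ge0 ?subr_ge0 ?(ltW ab)//.
  by rewrite -powRrM divff ?gt_eqF// powRr1.
apply: gt0_ler_poweR.
- by rewrite invr_ge0 ltW.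
- by rewrite in_itv/= leey andbT lee_fin mulr_ge0 ?powR_ge0// subr_ge0 ltW.
- by rewrite in_itv/= leey andbT integral_ge0.
rewrite -integral_cst_itv ?powR_ge0 ?(ltW ab)//; apply: ge0_le_integralT => x.
  by rewrite patchE; case: ifP => //=; rewrite lee_fin powR_ge0.
rewrite /= [in X in (X <= _)%E]patchE mem_setE in_itv /=.
case: ifPn => xab; rewrite lee_fin ?powR_ge0//.
by apply: ge0_ler_powR => //; rewrite ?nnegrE ?(ltW r0)//; exact: fJ.
Qed.

End LpNorm.

(** * Finite differences and a lower bound for the modulus of smoothness *)

Section Differences.
Context {R : realType}.
Implicit Types (P A : {poly R}) (x h : R).

(** The signed binomials are the coefficients of [(X - 1)^k]. Hence the difference of order [k + 1]
    of [P] is that of order [k] of [P(x + h) - P(x)], whose degree is lower. *)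
Lemma finite_difference_poly k P x h : (size P <= k)%N ->
  \sum_(i < k.+1) 'C(k, i)%:R * (-1) ^+ (k - i) * P.[x + i%:R * h] = 0.
Proof.
have E Q : \sum_(i < k.+1) 'C(k, i)%:R * (-1) ^+ (k - i) * Q.[x + i%:R * h] =
   \sum_(i < k.+1) (('X - 1%:P) ^+ k : {poly R})`_i * Q.[x + i%:R * h].
  by apply: eq_bigr => i _; rewrite coef_exp_XsubC -1?ltnS// ['C(_, _)%:R * _]mulrC.
rewrite {}E; elim: k P => [|k IHk] P sP.
  move: sP; rewrite leqn0 size_poly_eq0 => /eqP ->.
  by rewrite big1// => i _; rewrite horner0 mulr0.
set Q := ('X - 1%:P) ^+ k in IHk.
have QS i : (('X - 1%:P) ^+ k.+1 : {poly R})`_i = (if i is j.+1 then Q`_j else 0) - Q`_i.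
  by rewrite exprSr mulrBr coefB coefMX mulr1; case: i.
have sP' : (size (P \Po ('X + h%:P) - P)%R <= k)%N.
  have sX : size ('X + h%:P) = 2%N.
    by rewrite size_polyDl size_polyX// (leq_ltn_trans (size_polyC_leq1 _)).
  have sPX : (size (P \Po ('X + h%:P))%R <= k.+1)%N by rewrite size_comp_poly2.
  apply/leq_sizeP => j kj; rewrite coefB.
  move: kj; rewrite leq_eqVlt => /predU1P[<-|kj]; last first.
    by rewrite !nth_default ?subrr// (leq_trans _ kj).
  move: sP; rewrite leq_eqVlt => /predU1P[sP|sP]; last first.
    by rewrite !nth_default ?subrr// size_comp_poly2.
  have : lead_coef (P \Po ('X + h%:P)) = lead_coef P.
    rewrite lead_coef_comp ?sX// lead_coefDl ?size_polyX.
      by rewrite lead_coefX expr1n mulr1.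
    by rewrite (leq_ltn_trans (size_polyC_leq1 _)).
  by rewrite !lead_coefE size_comp_poly2// sP/= => ->; rewrite subrr.
rewrite -[RHS](IHk _ sP').
under eq_bigr do rewrite QS mulrBl.
rewrite sumrB big_ord_recl mul0r add0r [in X in _ - X]big_ord_recr /=.
have -> : Q`_k.+1 = 0 by rewrite nth_default// size_exp_XsubC.
rewrite mul0r addr0 -sumrB; apply: eq_bigr => i _.
rewrite -mulrBr hornerD hornerN horner_comp hornerD hornerX hornerC.
by congr (_ * (_.[_] - _)); rewrite /bump /= add1n -natr1; ring.
Qed.

(* With the step h = d / k, all nodes of the difference centred at z + y - k h / 2
   but the last one lie to the left of z, so only A survives. *)
Lemma modulus_smoothness_itv_ge k : (0 < k)%N -> exists kap m : R,
  [/\ 0 < kap, 0 < m & forall f a b z d P A i0, 0 < d -> a <= z - d -> z + d <= b ->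
    (size P <= k)%N -> (size A <= k)%N ->
    (forall x, z - d <= x <= z -> f x = P.[x]) ->
    (forall x, z <= x <= z + d -> f x = P.[x] + A.[x]) ->
    forall p : \bar R, (0 < p)%E ->
    ((m * `|(A \Po (d *: 'X + z%:P))`_i0| * Lp_scale p (kap * d))%:E
      <= modulus_smoothness_itv k f a b p)%E].
Proof.
move=> k0; have [kap [kap0 kap1 H]] := poly_large_on_interval (R := R) k.
pose n : R := k%:R.
have n0 : 0 < n by rewrite ltr0n.
have n1 : 1 <= n by rewrite ler1n.
(* The centres used below fill an interval of length [2 * kap / n * d]; passing from scale [d] to
   [h = d / n] shrinks coefficients by at most [n ^+ k]. *)
exists (2 * kap / n), (kap / n ^+ k); split.
- by rewrite divr_gt0// mulr_gt0.
- by rewrite divr_gt0// exprn_gt0.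
move=> f a b z d P A i0 d0 az zb sP sA fP fA p p0.
pose An := A \Po (d *: 'X + z%:P).
have sAn : (size An <= k)%N.
  by rewrite size_comp_affine.
have [|u [u1 u2 Hu]] := H (An \Po (n^-1 *: 'X)) i0.
  by rewrite size_comp_poly2// size_scale ?invr_eq0 ?gt_eqF// size_polyX.
pose h := d / n.
have h0 : 0 < h by rewrite divr_gt0.
have nh : n * h = d by rewrite mulrC divfK// gt_eqF.
have hd : h <= d by rewrite -nh ler_peMl// ltW.
have coefE : `|An`_i0| / n ^+ k <= `|(An \Po (n^-1 *: 'X))`_i0|.
  rewrite coef_comp_scale normrM normrX normfV (gtr0_norm n0).
  have [ik|ki] := ltnP i0 k; last first.
    by rewrite nth_default ?normr0 ?mul0r// (leq_trans sAn).
  rewrite -exprVn; apply: ler_wpM2l => //; apply: ler_wiXn2l.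
  - by rewrite invr_ge0 ltW.
  - by rewrite invf_le1.
  - exact: ltnW.
have diffE v : 0 <= v <= 1 ->
    sym_difference k h f (z - d / 2 + h * v) `[a, b] = An.[v / n].
  move=> /andP[v0 v1]; have hv : h * v <= h by rewrite ler_piMr// ltW.
  have hv0 : 0 <= h * v by rewrite mulr_ge0// ltW.
  rewrite /sym_difference -/n nh ifT; last first.
    by apply/asboolP; rewrite /= !in_itv /=; split; lra.
  have -> : z - d / 2 + h * v - d / 2 = z - d + h * v by lra.
  have := finite_difference_poly (z - d + h * v) h sP.
  rewrite !big_ord_recr /= binn subnn expr0 !mul1r -/n nh.
  rewrite (_ : z - d + h * v + d = z + h * v); last by lra.
  rewrite fA; last by apply/andP; split; lra.
  have -> : \sum_(i < k) 'C(k, i)%:R * (-1) ^+ (k - i) * f (z - d + h * v + i%:R * h) =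
    \sum_(i < k) 'C(k, i)%:R * (-1) ^+ (k - i) * P.[z - d + h * v + i%:R * h].
    apply: eq_bigr => i _; congr (_ * _); apply: fP.
    have ih : i%:R * h <= d - h.
      have : i.+1%:R * h <= d by rewrite -nh ler_pM2r// ler_nat.
      by rewrite -natr1 mulrDl mul1r; lra.
    have : 0 <= i%:R * h by rewrite mulr_ge0// ltW.
    by move=> ?; apply/andP; split; lra.
  rewrite addrA => ->; rewrite add0r /An horner_comp hornerD hornerZ hornerX hornerC; congr (A.[_]).
  by rewrite /h; field; rewrite gt_eqF.
apply: le_trans (_ : Lp_norm `[a, b] p (fun x => sym_difference k h f x `[a, b]) <= _)%E; last first.
  apply: ereal_sup_ubound; exists h => //=.
  by rewrite in_itv /= h0 /=; lra.
pose x0 := z - d / 2 + h * (u - kap); pose x1 := z - d / 2 + h * (u + kap).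
have x10 : x1 - x0 = 2 * kap / n * d.
  by rewrite /x1 /x0 /h; field; rewrite gt_eqF.
rewrite -/An -x10; apply: Lp_norm_ge => //.
- by rewrite mulr_ge0 ?divr_ge0 ?exprn_ge0 ?(ltW kap0) ?(ltW n0).
- by rewrite -subr_gt0 x10 mulr_gt0// divr_gt0// mulr_gt0.
move=> x /andP[xx0 xx1].
pose v := (x - (z - d / 2)) / h.
have vE : x = z - d / 2 + h * v by rewrite /v [h * _]mulrC divfK ?gt_eqF// addrC subrK.
have v1 : u - kap <= v by rewrite /v ler_pdivlMr//; move: xx0; rewrite /x0; lra.
have v2 : v <= u + kap by rewrite /v ler_pdivrMr//; move: xx1; rewrite /x1; lra.
have hv : h * v <= h by rewrite ler_piMr// ?ltW//; lra.
have hv0 : 0 <= h * v by rewrite mulr_ge0 ?(ltW h0)//; lra.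
split.
  rewrite /= in_itv /= vE; apply/andP; split; last by lra.
  by lra.
rewrite vE diffE; last by apply/andP; split; lra.
have := Hu v; rewrite horner_comp hornerZ hornerX [n^-1 * v]mulrC => /(_ _) Hv.
apply: le_trans (Hv _); last by rewrite ler_norml; lra.
by rewrite mulrAC -mulrA ler_pM2l// mulrC.
Qed.

End Differences.

(** * Piecewise polynomials *)

Section Smoothness.
Context {R : realType}.
Implicit Types (P Q : {poly R}) (f : R -> R) (a b c : R).

Lemma within_continuous_eq_poly f P a b a' b' : a' <= a -> a < b -> b <= b' ->
  {within `[a', b'], continuous f} ->
  (forall x, a < x < b -> f x = P.[x]) -> forall x, a <= x <= b -> f x = P.[x].
Proof.
move=> a'a ab bb' fc fP x /andP[ax xb].
have {}fc : {within `[a, b], continuous f}.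
  apply: continuous_subspaceW fc => y /=; rewrite !in_itv /= => /andP[ay yb].
  by rewrite (le_trans a'a)// (le_trans yb).
have Pc y : {for y, continuous (horner P)}.
  by apply/differentiable_continuous/derivable1_diffP/derivable_horner.
have [_ fa fb] := (continuous_within_itvP f ab).1 fc.
move: ax; rewrite le_eqVlt => /predU1P[<-|ax].
  apply: (@cvg_unique _ _ (f @ a^'+)) => //.
  have : horner P x @[x --> a^'+] --> P.[a] by apply: cvg_at_right_filter; exact: Pc.
  apply: cvg_trans; apply: near_eq_cvg; near=> y.
  by apply/esym/fP/andP; split; near: y; [exact: nbhs_right_gt|exact: nbhs_right_lt].
move: xb; rewrite le_eqVlt => /predU1P[->|xb]; last by rewrite fP// ax xb.
apply: (@cvg_unique _ _ (f @ b^'-)) => //.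
have : horner P x @[x --> b^'-] --> P.[b] by apply: cvg_at_left_filter; exact: Pc.
apply: cvg_trans; apply: near_eq_cvg; near=> y.
by apply/esym/fP/andP; split; near: y; [exact: nbhs_left_gt|exact: nbhs_left_lt].
Unshelve. all: by end_near. Qed.

Lemma Ck_on_continuous a b k f : Ck_on a b k f -> {within `[a, b], continuous f}.
Proof. by case: k => [|k] []. Qed.

(** Values agree at [c] by continuity; the induction passes to the derivative [g], whose pieces are
    [P'] and [Q']. It makes the low-order terms of the jump at a knot vanish. *)
Lemma Ck_on_derivn_eq k f P Q a b a' b' c : a' <= a -> a < c -> c < b -> b <= b' ->
  Ck_on a' b' k f -> (forall x, a < x < c -> f x = P.[x]) ->
  (forall x, c < x < b -> f x = Q.[x]) ->
  forall i, (i <= k)%N -> P^`(i).[c] = Q^`(i).[c].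
Proof.
move=> a'a ac cb bb'; elim: k f P Q => [|k IHk] f P Q fk fP fQ [|i] // ik.
- rewrite !derivn0; have fc := Ck_on_continuous fk.
  rewrite -(within_continuous_eq_poly a'a ac _ fc fP) ?lexx ?(ltW ac)//; last by lra.
  by rewrite (within_continuous_eq_poly _ cb bb' fc fQ) ?lexx ?(ltW cb)//; lra.
- rewrite !derivn0; have fc := Ck_on_continuous fk.
  rewrite -(within_continuous_eq_poly a'a ac _ fc fP) ?lexx ?(ltW ac)//; last by lra.
  by rewrite (within_continuous_eq_poly _ cb bb' fc fQ) ?lexx ?(ltW cb)//; lra.
have [_ [g gk fg]] := fk.
have deriv_eq (p : {poly R}) u v : a' <= u -> v <= b' ->
    (forall x, u < x < v -> f x = p.[x]) -> forall x, u < x < v -> g x = p^`().[x].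
  move=> a'u vb' fp x /andP[ux xv].
  have df : is_derive x 1 f (g x) by apply: fg; rewrite in_itv /=; apply/andP; split; lra.
  have dp : is_derive x 1 f p^`().[x].
    apply: (near_eq_is_derive _ (is_derive_horner p x)); near=> y; apply/esym/fp/andP.
    by split; near: y; [exact: lt_nbhsr|exact: lt_nbhsl].
  by have := @derive_val _ _ _ _ _ _ _ df; rewrite derive_val.
rewrite !derivSn; apply: (IHk g) => //.
  by apply: deriv_eq => //; lra.
by apply: deriv_eq => //; lra.
Unshelve. all: by end_near. Qed.

(** After [k] differentiations the truncated powers still have a positive exponent and are
    continuous. *)
Lemma Ck_on_tspline k n P l a b :
  Ck_on a b k (fun x => P.[x] + tspline (k + n).+1 l x).
Proof.
have cont i Q l' : {within `[a, b], continuous (fun x => Q.[x] + tspline i.+1 l' x)}.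
  apply: continuous_subspaceT => x; apply: (@continuousD _ _ _ (horner Q)).
    exact/differentiable_continuous/derivable1_diffP/derivable_horner.
  exact: continuous_tspline.
elim: k P l => [|k IHk] P l /=; split => //; try exact: cont.
exists (fun x => P^`().[x] + tspline (k + n).+1 (tscale (k + n).+2%:R l) x) => //.
move=> x _; rewrite tspline_scale; have d := is_derive_tspline (k + n) l x.
by have d' := is_derive_horner P x; exact: is_deriveD.
Qed.

Lemma is_ppf_tspline n m (zt : nat -> R) P l : (size P <= n.+2)%N ->
  (forall i, (i < m)%N -> zt i < zt i.+1) ->
  (forall p, p \in l -> exists2 i, (i <= m)%N & p.2 = zt i) ->
  is_ppf n.+1 m zt (fun x => P.[x] + tspline n.+1 l x).
Proof.
move=> sP zt_lt lzt i im.
have zt_homo j k : (j <= k)%N -> (k <= m)%N -> zt j <= zt k.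
  elim: k => [|k IHk]; first by rewrite leqn0 => /eqP ->.
  rewrite leq_eqVlt => /predU1P[->//|jk] km.
  by apply: le_trans (IHk jk (ltnW km)) _; exact/ltW/zt_lt.
pose l' := [seq p <- l | p.2 <= zt i].
exists (P + tspline_poly n.+1 l').
  by rewrite (leq_trans (size_polyD _ _))// geq_max sP size_tspline_poly.
move=> x; rewrite in_itv /= => /andP[ix xi]; rewrite hornerD; congr (_ + _).
rewrite -tspline_right; last first.
  by move=> p; rewrite mem_filter => /andP[pi _]; apply: le_trans (ltW ix).
rewrite /tspline big_filter [RHS]big_mkcond/= [LHS]big_seq [RHS]big_seq.
apply: eq_bigr => p /lzt[j jm pj].
case: ifPn => //; rewrite pj -ltNge => ij; rewrite tpow_left ?mulr0//.
apply: le_trans (ltW xi) _; apply: (zt_homo _ _ _ jm); rewrite ltnNge.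
by apply/negP => ji; move: ij; rewrite ltNge zt_homo// ltnW.
Qed.

End Smoothness.

(** * The spline at a knot and the remesh *)

Section KnotSpline.
Context {R : realType}.
Implicit Types (K : set R) (z d x : R) (l : seq (R * R)) (P A : {poly R}).

Lemma coef_le_argmax A : exists i0, coef_le A `|A`_i0|.
Proof.
suff [i0 H] : exists i0, forall i, (i < size A)%N -> `|A`_i| <= `|A`_i0|.
  exists i0 => i; have [/H//|sA] := ltnP i (size A).
  by rewrite nth_default ?normr0.
elim: (size A) => [|n [i0 IHn]]; first by exists 0%N.
have [le_n|lt_n] := leP `|A`_n| `|A`_i0|; [exists i0|exists n] => i.
  by rewrite ltnS leq_eqVlt => /predU1P[->|/IHn].
rewrite ltnS leq_eqVlt => /predU1P[->//|/IHn H].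
exact: le_trans H (ltW lt_n).
Qed.

Lemma derivn_comp_affine m P z d :
  (P \Po (d *: 'X + z%:P))^`(m) = d ^+ m *: (P^`(m) \Po (d *: 'X + z%:P)).
Proof.
elim: m => [|m IHm]; first by rewrite expr0 scale1r !derivn0.
rewrite !derivnS IHm derivZ deriv_comp derivD derivZ derivX derivC addr0.
by rewrite alg_polyC mulrC mul_polyC scalerA -exprSr.
Qed.

(** [local_spline] transported by [x = z + d * y], with [i0] at a largest coefficient of the
    rescaled [A]. The same coefficient bounds [A] itself and, later, the modulus from below. *)
Lemma knot_spline q0 r0 (q := q0.+1) (r := r0.+1) (D := (q0 + r0).+2) :
  exists C eta : R, [/\ 0 < C, 0 < eta & forall K z d, 0 < d ->
  fine_on K (eta * d) (z - d) (z + d) ->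
  forall P A, (size P <= D.+1)%N -> (size A <= D.+1)%N ->
    (forall i, (i < q)%N -> A^`(i).[z] = 0) ->
    (forall x, z - d <= x <= z -> 0 <= P^`(q).[x]) ->
    (forall x, z <= x <= z + d -> 0 <= (P + A)^`(q).[x]) ->
  exists l i0, [/\ knots_in K (z - d) (z + d) l, tspline_poly D l = A,
    forall x, `|x - z| <= d -> 0 <= P^`(q).[x] + (D ^_ q)%:R * tspline r l x,
    forall x, `|x - z| <= d ->
      `|tspline D l x| <= C * `|(A \Po (d *: 'X + z%:P))`_i0| &
    forall x, `|x - z| <= d -> `|A.[x]| <= C * `|(A \Po (d *: 'X + z%:P))`_i0|]].
Proof.
have [C [eta [C0 eta0 H]]] := local_spline (R := R) q0 r0.
exists (C + D.+1%:R), eta; split => //; first by rewrite addr_gt0.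
move=> K z d d0 Kf P A sP sA Aq P0 PA0.
pose aff := d *: 'X + z%:P; pose An := A \Po aff.
have affE y : aff.[y] = d * y + z by rewrite hornerD hornerZ hornerX hornerC.
have [i0 Ai0] := coef_le_argmax An.
have Kn : fine_on [set t | K (z + d * t)] eta (-1) 1.
  move=> x /andP[x1 x2]; have [|t [Kt t1 t2]] := Kf (z + d * x).
    by apply/andP; split; nra.
  exists ((t - z) / d); split => /=.
  - by rewrite [d * _]mulrC divfK ?gt_eqF// addrC subrK.
  - by rewrite ler_pdivlMr//; nra.
  - by rewrite ler_pdivrMr//; nra.
have dq0 : 0 <= d ^+ q by rewrite exprn_ge0// ltW.
have [|||||l [lK lE lpos lB]] := H _ Kn (P \Po aff) An i0 _ _ _ Ai0.
- by rewrite size_comp_affine.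
- by rewrite size_comp_affine.
- move=> i iq; have : (An^`(i)).[0] = 0.
    by rewrite derivn_comp_affine hornerZ horner_comp affE mulr0 add0r Aq// mulr0.
  rewrite horner_coef0 coef_derivn addn0 ffactnn => /eqP.
  by rewrite mulrn_eq0 -leqn0 leqNgt fact_gt0 => /eqP.
- move=> x /andP[x1 x2]; rewrite derivn_comp_affine hornerZ mulr_ge0//.
  by rewrite horner_comp affE P0//; apply/andP; split; nra.
- move=> x /andP[x1 x2]; rewrite /An -comp_polyD derivn_comp_affine hornerZ mulr_ge0//.
  by rewrite horner_comp affE PA0//; apply/andP; split; nra.
have nrm x : `|x - z| <= d -> `|(x - z) / d| <= 1.
  by move=> xz; rewrite normrM normfV (gtr0_norm d0) ler_pdivrMr// mul1r.
have back x : d * ((x - z) / d) + z = x by rewrite mulrC divfK ?gt_eqF// subrK.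
have DE : D = (q + r)%N by rewrite /D /q /r addSn addnS.
exists (taffine (d ^- D) z d l), i0; split.
- by move=> _ /mapP[p /lK[Kp p1 p2] ->] /=; split => //; nra.
- exact: tspline_poly_affine.
- move=> x /nrm/lpos; rewrite derivn_comp_affine hornerZ horner_comp affE back.
  rewrite tspline_affine// -/q -/r -/D => H1.
  have dq : 0 < d ^+ q by rewrite exprn_gt0.
  have dD : d ^+ q * (d ^- D * d ^+ r) = 1.
    by rewrite mulrCA -exprD -DE mulVf// expf_neq0// gt_eqF.
  rewrite -(pmulr_rge0 _ dq) mulrDr [X in _ + X](_ : _ =
    d ^+ q * (d ^- D * d ^+ r) * ((D ^_ q)%:R * tspline r l ((x - z) / d))).
    by rewrite dD mul1r.
  by ring.
- move=> x /nrm/lB H1; rewrite tspline_affine// mulVf ?expf_neq0 ?gt_eqF// mul1r.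
  by apply: le_trans H1 _; rewrite ler_wpM2r// lerDl.
- move=> x /nrm x1; have := horner_coef_le _ Ai0 x1.
  rewrite horner_comp affE back => /(_ D.+1) H1.
  apply: le_trans (H1 _) _; first by rewrite size_comp_affine.
  by rewrite ler_wpM2r// lerDr ltW.
Qed.

End KnotSpline.

(** * Partitions, remeshes and the intervals I_j *)

Section Partitions.
Context {R : realType}.
Implicit Types (n m i j : nat) (z zt : nat -> R) (x : R).

Lemma partition_homo n z : is_partition n z ->
  forall i j, (i <= j)%N -> (j <= n)%N -> z i <= z j.
Proof.
move=> [_ _ zlt] i; elim=> [|j IHj]; first by rewrite leqn0 => /eqP ->.
rewrite leq_eqVlt => /predU1P[->//|ij] jn.
by apply: le_trans (IHj ij (ltnW jn)) _; exact/ltW/zlt.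
Qed.

Lemma partition_locate n z x : is_partition n z -> -1 <= x -> x < 1 ->
  exists i, [/\ (i < n)%N, z i <= x & x < z i.+1].
Proof.
move=> [z0 zn _]; rewrite -z0 -zn => zx; elim: n {zn} => [|n IHn].
  by move=> /(le_lt_trans zx); rewrite ltxx.
have [xn _|nx xn] := ltP x (z n); last by exists n.
by have [i [ii ? ?]] := IHn xn; exists i; rewrite ltnS ltnW.
Qed.

Lemma knot_gapE n z j : (forall i, (i < n)%N -> z i < z i.+1) -> (j < n)%N ->
  knot_gap n z j%:Z = (z j.+1 - z j)%:E.
Proof.
move=> zlt jn; rewrite /knot_gap -PoszD addn1 /= jn ltnW//=.
by rewrite ger0_norm// subr_ge0 ltW// zlt.
Qed.

(** For both cells adjacent to [z j.+1] the minimum in the remesh condition includes the two gaps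
    around it, so mesh intervals near it have length at most [eta / 2] times the smaller gap, that
    is [eta * d]. *)
Lemma remesh_fine (eta : R) n z m zt j (d := Num.min (z j.+1 - z j) (z j.+2 - z j.+1) / 2) :
  0 <= eta -> is_partition n z -> is_remesh (eta / 2) n z m zt -> (j.+1 < n)%N ->
  fine_on [set t | exists2 i, (i <= m)%N & t = zt i] (eta * d)
    (z j.+1 - d) (z j.+1 + d).
Proof.
move=> eta0 zP [ztP zr] jn x /andP[x1 x2].
have [z0 zn zlt] := zP.
have jn' := ltnW jn.
have g1 : z j < z j.+1 by exact: zlt.
have g2 : z j.+1 < z j.+2 by exact: zlt.
have d1 : d <= (z j.+1 - z j) / 2 by rewrite ler_pM2r ?invr_gt0// ge_min lexx.
have d2 : d <= (z j.+2 - z j.+1) / 2 by rewrite ler_pM2r ?invr_gt0// ge_min lexx orbT.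
have zj : -1 <= z j by rewrite -z0; apply: (partition_homo zP) => //; exact: ltnW.
have zj2 : z j.+2 <= 1 by rewrite -zn; exact: (partition_homo zP).
have [||i [im zi iz]] := partition_locate ztP (x := x); [lra|lra|].
exists (zt i); split => //=; first by exists i => //; exact: ltnW.
suff : zt i.+1 - zt i <= eta * d by lra.
have gap1 : knot_gap n z j%:Z = (z j.+1 - z j)%:E by exact: knot_gapE.
have gap2 : knot_gap n z j.+1%:Z = (z j.+2 - z j.+1)%:E by exact: knot_gapE.
have dE : eta * d = eta / 2 * Num.min (z j.+1 - z j) (z j.+2 - z j.+1).
  by rewrite /d; field.
rewrite dE -lee_fin EFinM EFin_min -gap1 -gap2.
have eta20 : (0 <= (eta / 2)%:E)%E by rewrite lee_fin divr_ge0.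
have [xz|zx] := ltP x (z j.+1).
  apply: le_trans (zr j jn' i im _) _.
    by exists x; split; rewrite /= in_itv /=; apply/andP; split; lra.
  apply: lee_wpmul2l => //.
  by rewrite -[(j%:Z + 1)%R]PoszD addn1 ge_min lexx orbT.
apply: le_trans (zr j.+1 jn i im _) _.
  (* [x] may be the knot itself and hence outside of the open cell; a point to its right lies in
     both intervals. *)
  exists ((x + Num.min (zt i.+1) (z j.+2)) / 2).
  have : x < Num.min (zt i.+1) (z j.+2) by rewrite lt_min iz/=; lra.
  have : Num.min (zt i.+1) (z j.+2) <= zt i.+1 by rewrite ge_min lexx.
  have : Num.min (zt i.+1) (z j.+2) <= z j.+2 by rewrite ge_min lexx orbT.
  by move=> *; split; rewrite /= in_itv /=; apply/andP; split; lra.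
apply: lee_wpmul2l => //.
have -> : j.+1%:Z - 1 = j%:Z by rewrite intS addrC addKr.
by rewrite !le_min !ge_min !lexx ?orbT.
Qed.

Lemma Iset_left0 n z : Iset_left n z 0 = z 0%N.
Proof. by rewrite /Iset_left /= min0n; lra. Qed.

Lemma Iset_leftS n z j : (j < n)%N -> Iset_left n z j.+1 = (z j + z j.+1) / 2.
Proof.
move=> jn; rewrite /Iset_left.
have -> : j.+1%:Z - 1 = j%:Z by rewrite intS addrC addKr.
by rewrite /= (minn_idPl jn) (minn_idPl (ltnW jn)).
Qed.

Lemma Iset_rightE n z j : (j < n)%N -> Iset_right n z j = (z j + z j.+1) / 2.
Proof.
move=> jn; rewrite /Iset_right -PoszD addn1 /=.
by rewrite (minn_idPl jn) (minn_idPl (ltnW jn)).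
Qed.

Lemma Iset_right_last n z : Iset_right n z n = z n.
Proof.
by rewrite /Iset_right -PoszD addn1 /= minnn (minn_idPr (leqnSn _)); lra.
Qed.

Lemma Iset_cover n z x : is_partition n z -> -1 <= x <= 1 ->
  exists2 j, (j <= n)%N & Iset_left n z j <= x <= Iset_right n z j.
Proof.
move=> zP /andP[x1 x2]; have [z0 zn zlt] := zP.
move: x2; rewrite le_eqVlt => /predU1P[->|x2].
  exists n => //; rewrite Iset_right_last zn lexx andbT.
  case: n zP z0 zn zlt => [|n] zP z0 zn zlt; first by rewrite Iset_left0 zn.
  by rewrite Iset_leftS// zn; have := zlt n (leqnn _); lra.
have [i [ii zi iz]] := partition_locate zP x1 x2.
have [xm|mx] := leP x ((z i + z i.+1) / 2).
  exists i; first exact: ltnW.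
  rewrite Iset_rightE// xm andbT; case: i ii zi iz xm => [|i] ii zi iz xm.
    by rewrite Iset_left0.
  by rewrite Iset_leftS 1?ltnW//; have := zlt i (ltnW ii); lra.
exists i.+1 => //; rewrite Iset_leftS// (ltW mx)/=.
move: ii; rewrite leq_eqVlt => /predU1P[<-|ii].
  by rewrite Iset_right_last ltW.
by rewrite Iset_rightE//; have := zlt i.+1 ii; lra.
Qed.

End Partitions.

(** * Glueing the splines of the single knots *)

Section Glueing.
Context {R : realType}.
Implicit Types (n m i j k : nat) (z : nat -> R) (x : R) (P : nat -> {poly R}).

(** Radius of the neighbourhood of [z j] in which [s] is altered; meant for interior knots, where
    [j.-1] is not truncated. *)
Definition half_gap z j : R := Num.min (z j - z j.-1) (z j.+1 - z j) / 2.

Lemma half_gap_le z j :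
  half_gap z j <= (z j - z j.-1) / 2 /\ half_gap z j <= (z j.+1 - z j) / 2.
Proof.
by split; rewrite ler_pM2r ?invr_gt0// ge_min lexx ?orbT.
Qed.

Lemma half_gap_gt0 n z j : is_partition n z -> (0 < j < n)%N -> 0 < half_gap z j.
Proof.
move=> [_ _ zlt]; case: j => // j /= jn; rewrite divr_gt0// lt_min !subr_gt0.
by rewrite !zlt// ltnW.
Qed.

(** Half a gap reaches at most the midpoint of the next cell. On I_j the splines of earlier knots
    are therefore already polynomials. *)
Lemma Iset_left_ge n z i j : is_partition n z -> (0 < i < j)%N -> (j <= n)%N ->
  z i + half_gap z i <= Iset_left n z j.
Proof.
move=> zP; case: j => [|j]; first by rewrite ltn0 andbF.
rewrite ltnS => /andP[i0 ij] jn; rewrite Iset_leftS//.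
have zij := partition_homo zP ij (ltnW jn).
have zij1 : z i.+1 <= z j.+1 by apply: (partition_homo zP); rewrite ?ltnS.
have [_ g] := half_gap_le z i.
lra_from zij zij1 g.
Qed.

Lemma Iset_right_le n z i j : is_partition n z -> (j < i < n)%N ->
  Iset_right n z j <= z i - half_gap z i.
Proof.
move=> zP; case: i => // i /andP[]; rewrite ltnS => ji jn.
rewrite Iset_rightE; last exact: leq_ltn_trans ji (ltnW jn).
have zij := partition_homo zP ji (ltnW (ltnW jn)).
have zij1 : z j.+1 <= z i.+1 by apply: (partition_homo zP); rewrite ?ltnS// ltnW.
have [g _] := half_gap_le z i.+1; rewrite /= in g.
lra_from zij zij1 g.
Qed.

Lemma tspline_flatten k (L : nat -> seq (R * R)) n x :
  tspline k (flatten [seq L i | i <- iota 0 n]) x =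
  \sum_(0 <= i < n) tspline k (L i) x.
Proof. by rewrite /tspline big_flatten big_map /index_iota subn0. Qed.

(** On I_j the splines of earlier knots are polynomials whose sum telescopes to [P j.-1 - P 0],
    those of later knots vanish, and only the one at [z j] remains. The order [m] is 0 for the value
    and [q] for the derivative. *)
Lemma glued_tspline n z P (L : nat -> seq (R * R)) D m k : is_partition n z ->
  (forall j, (0 < j < n)%N ->
     (forall p, p \in L j -> z j - half_gap z j <= p.2 <= z j + half_gap z j) /\
     tspline_poly D (L j) = P j - P j.-1) ->
  (forall j, ~~ (0 < j < n)%N -> L j = [::]) -> D = (m + k.+1)%N ->
  forall j x, (j <= n)%N -> Iset_left n z j <= x <= Iset_right n z j ->
  (P 0%N)^`(m).[x] +
     (D ^_ m)%:R * tspline k.+1 (flatten [seq L i | i <- iota 0 n]) x =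
  (P j.-1)^`(m).[x] + (D ^_ m)%:R * tspline k.+1 (L j) x.
Proof.
move=> zP HL L0 DE j x jn /andP[jx xj].
rewrite tspline_flatten mulr_sumr (big_cat_nat (n := j))//=.
pose g i := (P i.-1)^`(m).[x].
have -> : \sum_(0 <= i < j) (D ^_ m)%:R * tspline k.+1 (L i) x = g j - g 0%N.
  rewrite -telescope_sumr//; apply: eq_big_nat => -[|i] /andP[_ ij].
    by rewrite L0// /tspline big_nil mulr0 subrr.
  have ijn : (0 < i.+1 < n)%N by exact: leq_trans ij jn.
  have [Lz LE] := HL i.+1 ijn.
  rewrite tspline_right; last first.
    move=> p /Lz/andP[_ pz]; apply: le_trans pz _; apply: le_trans jx.
    exact: Iset_left_ge.
  by rewrite DE -hornerZ -derivn_tspline_poly -DE LE derivnB hornerD hornerN.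
have -> : \sum_(j <= i < n) (D ^_ m)%:R * tspline k.+1 (L i) x =
    (D ^_ m)%:R * tspline k.+1 (L j) x.
  move: jn; rewrite leq_eqVlt => /predU1P[jn|jn].
    by rewrite jn big_geq// L0 ?ltnn ?andbF// /tspline big_nil mulr0.
  rewrite big_ltn// big_nat_cond big1 ?addr0// => i /andP[/andP[ji ii] _].
  have ijn : (0 < i < n)%N by rewrite ii andbT (leq_ltn_trans _ ji).
  have [Lz _] := HL i ijn.
  rewrite tspline_left ?mulr0// => p /Lz/andP[zp _]; apply: le_trans zp.
  by apply: le_trans xj _; apply: Iset_right_le => //; rewrite ji.
by rewrite /g /= addrA addrCA subrr addr0.
Qed.

Lemma is_derive_tspline_chain n m (P : {poly R}) l (x : R) : (m.+1 < n)%N ->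
  is_derive x 1 (fun y => P^`(m).[y] + (n ^_ m)%:R * tspline (n - m) l y)
    (P^`(m.+1).[x] + (n ^_ m.+1)%:R * tspline (n - m.+1) l x).
Proof.
move=> mn; have [k kE] : exists k, (n - m = k.+2)%N.
  by exists (n - m).-2; rewrite -[LHS](subnK (_ : 1 < n - m)%N) ?addn2//; lia.
have -> : (n - m.+1 = k.+1)%N by lia.
rewrite kE ffactnSr kE natrM derivnS -mulrA.
have d := is_derive_tspline k l x; have d' := is_derive_horner P^`(m) x.
have d'' := @is_deriveZ _ _ _ _ (n ^_ m)%:R _ _ _ d.
exact: is_deriveD.
Qed.

End Glueing.

(** * The glued spline and its error *)

Theorem theorem1p1 (R : realType) (q r : nat) (hq : (0 < q)%N) (hr : (0 < r)%N) :
  exists (delta : R) (c : \bar R -> R),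
    [/\ 0 < delta,
        forall p : \bar R, (0 < p)%E -> 0 < c p &
        forall (n : nat) (z : nat -> R), is_partition n z ->
        forall s : R -> R,
          is_ppf (q + r) n z s -> qmonotone q `[-1, 1] s ->
          Ck_on (-1) 1 q.-1 s ->
        forall (m : nat) (zt : nat -> R), is_remesh delta n z m zt ->
        exists st : R -> R,
          [/\ is_spline (q + r) m zt st,
              qmonotone q `[-1, 1] st &
              forall p : \bar R, (0 < p)%E ->
              forall j : nat, (j <= n)%N ->
                (Lp_norm `[Iset_left n z j, Iset_right n z j] p
                   (fun x => (s x - st x)%R)
                 <= (c p)%:E * modulus_smoothness_itv (q + r + 1) s
                                 (Iset_left n z j) (Iset_right n z j) p)%E]].
Proof.
case: q hq => // q0 _; case: r hr => // r0 _.
have [C [eta [C0 eta0 HK]]] := knot_spline (R := R) q0 r0.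
have [kap [mu [kap0 mu0 HM]]] :=
  modulus_smoothness_itv_ge (R := R) (ltn0Sn (q0 + r0).+2).
(* [remesh_fine] asks for half of [eta]. The factor [Lp_scale p (2 / kap)] compares the length
   [2 * d j] carrying the error with the length [kap * d j] on which the difference is known to be
   large. *)
exists (eta / 2), (fun p => 2 * C / mu * Lp_scale p (2 / kap)); split.
- by rewrite divr_gt0.
- by move=> p p0; rewrite mulr_gt0 ?Lp_scale_gt0 ?divr_gt0// mulr_gt0.
move=> n z zP s sppf sq sC m zt remesh; have [z0 zn zlt] := zP.
have [ztP _] := remesh.
have [D DE] : exists D, D = (q0 + r0).+2 by eexists.
have qrD : (q0.+1 + r0.+1)%N = D by rewrite DE addSn addnS.
rewrite qrD addn1 in sppf *; rewrite -DE in HK HM.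
set q := q0.+1 in HK sq *; set r := r0.+1 in HK *.
have n0 : (0 < n)%N.
  by rewrite lt0n; apply/eqP => n00; move: zn; rewrite n00 z0; lra.
have z_ge i : (i <= n)%N -> -1 <= z i by move=> ii; rewrite -z0; exact: (partition_homo zP).
have z_le i : (i <= n)%N -> z i <= 1 by move=> ii; rewrite -zn; exact: (partition_homo zP).
have [P HP] : exists P : nat -> {poly R}, forall i, (i < n)%N ->
    (size (P i) <= D.+1)%N /\ forall x, z i < x < z i.+1 -> s x = (P i).[x].
  have [|P HP] := @choice nat {poly R} (fun i Q => (i < n)%N ->
      (size Q <= D.+1)%N /\ forall x, z i < x < z i.+1 -> s x = Q.[x]).
    move=> i; have [ii|ni] := ltnP i n; last by exists 0.
    have [Q sQ HQ] := sppf i ii; by exists Q.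
  by exists P.
have sP i x : (i < n)%N -> z i <= x <= z i.+1 -> s x = (P i).[x].
  move=> ii; have [_ Pi] := HP i ii; apply: within_continuous_eq_poly Pi x.
  - exact: z_ge (ltnW ii).
  - exact: zlt.
  - exact: z_le.
  - exact: Ck_on_continuous sC.
have Pq i x : (i < n)%N -> z i <= x <= z i.+1 -> 0 <= (P i)^`(q).[x].
  move=> ii; have [_ Pi] := HP i ii; apply: (qmonotone_derivn_ge0 _ _ _ sq Pi).
  - exact: zlt.
  - exact: z_ge (ltnW ii).
  - exact: z_le.
pose K := [set t | exists2 i, (i <= m)%N & t = zt i].
pose A j := P j - P j.-1.
pose d := half_gap z.
pose An j := A j \Po (d j *: 'X + (z j)%:P).
pose good j l i0 := [/\ knots_in K (z j - d j) (z j + d j) l, tspline_poly D l = A j,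
  forall x, `|x - z j| <= d j -> 0 <= (P j.-1)^`(q).[x] + (D ^_ q)%:R * tspline r l x,
  forall x, `|x - z j| <= d j -> `|tspline D l x| <= C * `|(An j)`_i0| &
  forall x, `|x - z j| <= d j -> `|(A j).[x]| <= C * `|(An j)`_i0|].
have goodP j : (0 < j < n)%N -> exists l i0, good j l i0.
  case: j => // j /= jn; have jn' := ltnW jn.
  have [sj HPj] := HP j jn'; have [sj1 HPj1] := HP j.+1 jn.
  have [g1 g2] := half_gap_le z j.+1; rewrite -/(d _) /= in g1 g2.
  have d0 : 0 < d j.+1 by apply: half_gap_gt0 zP _.
  have [|||||l [i0 Hl]] := HK K (z j.+1) (d j.+1) d0 _ (P j) (A j.+1) sj.
  - exact: remesh_fine (ltW eta0) zP remesh jn.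
  - by rewrite (leq_trans (size_polyD _ _))// geq_max sj1 size_polyN.
  - move=> i iq; rewrite derivnB hornerD hornerN; apply/eqP; rewrite subr_eq0.
    apply/eqP/esym; apply: (Ck_on_derivn_eq _ _ _ _ sC HPj HPj1) => //.
    + exact: z_ge (ltnW jn').
    + exact: zlt.
    + exact: zlt.
    + exact: z_le.
  - move=> x /andP[x1 x2]; apply: Pq => //; rewrite x2 andbT.
    by have := zlt j jn'; lra_from x1 g1.
  - move=> x /andP[x1 x2]; rewrite /A /= addrC subrK; apply: Pq => //; rewrite x1/=.
    by have := zlt j.+1 jn; lra_from x2 g2.
  by exists l, i0.
have [Li HL] : exists Li : nat -> seq (R * R) * nat, forall j,
    if (0 < j < n)%N then good j (Li j).1 (Li j).2 else (Li j).1 = [::].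
  have [|Li HL] := @choice nat (seq (R * R) * nat) (fun j li =>
      if (0 < j < n)%N then good j li.1 li.2 else li.1 = [::]); last by exists Li.
  move=> j; case: (boolP (0 < j < n)%N) => [/goodP[l [i0 Hl]]|_].
    by exists (l, i0).
  by exists ([::], 0%N).
pose L j := (Li j).1.
have Lgood j : (0 < j < n)%N -> good j (L j) (Li j).2.
  by move=> jn; have := HL j; rewrite jn.
have L0 j : ~~ (0 < j < n)%N -> L j = [::].
  by move=> /negbTE jn; have := HL j; rewrite jn.
have Lglue j : (0 < j < n)%N ->
    (forall p, p \in L j -> z j - half_gap z j <= p.2 <= z j + half_gap z j) /\
    tspline_poly D (L j) = P j - P j.-1.
  by move=> /Lgood[lK lE _ _ _]; split => // p /lK[_ -> ->].
pose l := flatten [seq L i | i <- iota 0 n].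
pose st x := (P 0%N).[x] + tspline D l x.
have stE j x : (j <= n)%N -> Iset_left n z j <= x <= Iset_right n z j ->
    st x = (P j.-1).[x] + tspline D (L j) x.
  move=> jn xj; have D0 : D = (0 + (q0 + r0).+2)%N by rewrite DE.
  have := glued_tspline zP Lglue L0 D0 jn xj.
  by rewrite ffactn0 !derivn0 !mul1r -DE.
have Dqr : D = (q + r0.+1)%N by rewrite -qrD.
have Dq : (D - q)%N = r by rewrite Dqr addKn.
(* For [i <= q], [G i] is the i-th derivative of [st]. *)
pose G i x := (P 0%N)^`(i).[x] + (D ^_ i)%:R * tspline (D - i) l x.
have GE j x : (j <= n)%N -> Iset_left n z j <= x <= Iset_right n z j ->
    G q x = (P j.-1)^`(q).[x] + (D ^_ q)%:R * tspline r (L j) x.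
  move=> jn xj; have := glued_tspline zP Lglue L0 Dqr jn xj.
  by rewrite /G Dq.
have st0 : st = G 0%N.
  by apply/funext => x; rewrite /G ffactn0 derivn0 mul1r subn0.
(* I_0 and I_n each lie in a single cell, and [j.-1] is its index in both cases. *)
have edge j x : (j <= n)%N -> ~~ (0 < j < n)%N ->
    Iset_left n z j <= x <= Iset_right n z j ->
    (j.-1 < n)%N /\ z j.-1 <= x <= z j.-1.+1.
  case: j => [|j] jn jn' /andP[jx xj].
    split => //=; rewrite Iset_left0 in jx; rewrite Iset_rightE// in xj.
    by rewrite jx/=; have := zlt 0%N n0; lra_from xj.
  have jn'' : j.+1 = n by move: jn jn'; rewrite leq_eqVlt /= => /orP[/eqP//|->].
  rewrite Iset_leftS// in jx; rewrite {1}jn'' Iset_right_last -jn'' in xj.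
  by split => //=; rewrite xj andbT; have := zlt j jn; lra_from jx.
have inner j x : (0 < j < n)%N -> Iset_left n z j <= x <= Iset_right n z j ->
    [/\ (j.-1 < n)%N, j.-1.+1 = j & z j.-1 <= x <= z j.+1].
  case: j => // j /= jn /andP[jx xj].
  rewrite Iset_leftS ?(ltnW jn)// in jx; rewrite Iset_rightE// in xj.
  split => //; first exact: ltnW.
  by have h1 := zlt j (ltnW jn); have h2 := zlt j.+1 jn; lra_from jx xj h1 h2.
have d_gt0 j : (0 < j < n)%N -> 0 < d j by exact: half_gap_gt0.
have L_left j x k : (0 < j < n)%N -> x <= z j - d j -> tspline k.+1 (L j) x = 0.
  move=> /Lgood[lK _ _ _ _] xj; apply: tspline_left => p /lK[_ jp _].
  exact: le_trans jp.
have L_right j x k : (0 < j < n)%N -> z j + d j <= x ->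
    tspline k (L j) x = (tspline_poly k (L j)).[x].
  move=> /Lgood[lK _ _ _ _] xj; apply: tspline_right => p /lK[_ _ pj].
  exact: le_trans pj _.
have far j x : (0 < j < n)%N -> x <= z j - d j \/ z j + d j <= x \/ `|x - z j| <= d j.
  move=> _; have /orP[H1|H1] := le_total x (z j - d j); first by left.
  have /orP[H2|H2] := le_total (z j + d j) x; first by right; left.
  by right; right; rewrite ler_norml; lra_from H1 H2.
(* Outside of the neighbourhood of [z j] the q-th derivative is that of [P j.-1] or of [P j]; inside
   it is controlled by [lpos]. *)
have Gq_ge0 x : -1 <= x <= 1 -> 0 <= G q x.
  move=> x1; have [j jn xj] := Iset_cover zP x1.
  rewrite (GE j)//; case: (boolP (0 < j < n)%N) => [jn'|jn']; last first.
    rewrite (L0 j jn') /tspline big_nil mulr0 addr0.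
    by have [j1n jx] := edge j x jn jn' xj; exact: Pq.
  have [j1n j1 /andP[jx xj1]] := inner j x jn' xj; have dj := d_gt0 j jn'.
  have [_ lE lpos _ _] := Lgood j jn'.
  have [xl|[xr|xm]] := far j x jn'; last exact: lpos.
    by rewrite L_left// mulr0 addr0 Pq// jx j1; lra_from xl dj.
  rewrite L_right// -hornerZ {1}Dqr -derivn_tspline_poly -Dqr lE -hornerD -derivnD.
  have /andP[_ jn2] := jn'.
  by rewrite /A addrC subrK Pq// xj1 andbT; lra_from xr dj.
have Iset_lt j : (j <= n)%N -> Iset_left n z j < Iset_right n z j.
  case: j => [|j] jn.
    by rewrite Iset_left0 Iset_rightE//; have := zlt 0%N n0; lra.
  rewrite Iset_leftS//; have h1 := zlt j jn.
  move: (jn); rewrite leq_eqVlt => /predU1P[jn'|jn'].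
    by rewrite {2}jn' Iset_right_last -jn'; lra_from h1.
  by rewrite Iset_rightE//; have h2 := zlt j.+1 jn'; lra_from h1 h2.
exists st; split.
- split.
    rewrite /st DE; apply: is_ppf_tspline; first by rewrite -DE; have [] := HP 0%N n0.
      by have [_ _] := ztP.
    move=> p /flattenP[_ /mapP[j _ ->]] pj.
    have jn : (0 < j < n)%N by apply: contraTT pj => /L0 ->.
    by have [lK _ _ _ _] := Lgood j jn; have [] := lK p pj.
  have := Ck_on_tspline (q0 + r0).+1 0 (P 0%N) l (- 1) 1.
  by rewrite addn0 /st DE.
- rewrite st0; apply: qmonotone_of_derive => [i x iq|x x1]; last exact: Gq_ge0.
  by apply: is_derive_tspline_chain; rewrite Dqr -addn1 leq_add.
move=> p p0 j jn; pose k := D.+1.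
have c0 : 0 < 2 * C / mu * Lp_scale p (2 / kap).
  by rewrite mulr_gt0 ?Lp_scale_gt0 ?divr_gt0// mulr_gt0.
(* One admissible step makes the supremum nonnegative. This settles [j = 0] and [j = n], where [st]
   equals [s] on I_j. *)
have mod0 : (0 <= modulus_smoothness_itv k s (Iset_left n z j) (Iset_right n z j) p)%E.
  pose h := Iset_right n z j - Iset_left n z j.
  apply: le_trans (_ : Lp_norm `[Iset_left n z j, Iset_right n z j] p
    (fun x => sym_difference k h s x `[Iset_left n z j, Iset_right n z j]) <= _)%E.
    exact: Lnorm_ge0.
  apply: ereal_sup_ubound; exists h => //=.
  by rewrite in_itv /= lexx andbT subr_gt0 Iset_lt.
case: (boolP (0 < j < n)%N) => [jn'|jn']; last first.
  apply: (@le_trans _ _ 0%E); last by rewrite mule_ge0// lee_fin ltW.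
  have s_st x : Iset_left n z j <= x <= Iset_right n z j -> s x - st x = 0.
    move=> xj; have [j1n jx] := edge j x jn jn' xj.
    by rewrite (sP j.-1)// (stE j)// (L0 j jn') /tspline big_nil addr0 subrr.
  apply: le_trans (Lp_norm_le (a := 0) (b := 0) p0 (lexx 0) (lexx 0) _ _) _.
  - by move=> x /=; rewrite in_itv /= => /s_st ->; rewrite normr0.
  - by move=> x /=; rewrite in_itv /= => /s_st ->.
  by rewrite mul0r.
have [lK lE lpos lB AB] := Lgood j jn'; have dj := d_gt0 j jn'.
set B := `|(An j)`_(Li j).2| in lB AB.
have B0 : 0 <= B by exact: normr_ge0.
have CB0 : 0 <= C * B by rewrite mulr_ge0// ltW.
have /andP[_ jn2] := jn'.
have [g1 g2] := half_gap_le z j; rewrite -/(d j) in g1 g2.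
have s_left x : z j.-1 <= x -> x <= z j -> s x = (P j.-1).[x].
  case: j jn' {jn lK lE lpos lB AB B B0 CB0 dj jn2 g1 g2 mod0} => // j /andP[_ jn] jx xj.
  by apply: sP; [exact: ltnW|rewrite jx].
have s_right x : z j <= x -> x <= z j.+1 -> s x = (P j.-1).[x] + (A j).[x].
  move=> jx xj; rewrite (sP j)//; last by rewrite jx.
  by rewrite /A hornerD hornerN addrC subrK.
have diff0 x : Iset_left n z j <= x <= Iset_right n z j ->
    x <= z j - d j \/ z j + d j <= x -> s x - st x = 0.
  move=> xj xd; have [j1n j1 /andP[jx xj1]] := inner j x jn' xj.
  rewrite (stE j)//; case: xd => xd.
    by rewrite s_left// ?DE ?L_left ?addr0 ?subrr//; lra_from xd dj.
  by rewrite s_right ?L_right ?lE ?subrr//; lra_from xd dj.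
(* Near [z j] the error is minus the local spline on the left and [A j] minus the local spline on
   the right, hence at most [2 * (C * B)]; elsewhere on I_j it is 0. *)
have LpE : (Lp_norm `[Iset_left n z j, Iset_right n z j] p (fun x => (s x - st x)%R)
    <= (2 * (C * B) * Lp_scale p (z j + d j - (z j - d j)))%:E)%E.
  apply: Lp_norm_le => //.
  - by rewrite mulr_ge0.
  - by lra_from dj.
  - move=> x; rewrite /= in_itv /= => xj.
    have [xl|[xr|xm]] := far j x jn'.
    + by rewrite diff0//; [rewrite normr0 mulr_ge0|left].
    + by rewrite diff0//; [rewrite normr0 mulr_ge0|right].
    have [j1n j1 /andP[jx xj1]] := inner j x jn' xj.
    have Hl := lB x xm; have Ha := AB x xm; rewrite (stE j)//.
    have /orP[xz|zx] := le_total x (z j).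
      by rewrite s_left// opprD addrA subrr sub0r normrN; lra_from Hl CB0.
    rewrite s_right//.
    rewrite (_ : _ - _ = (A j).[x] - tspline D (L j) x); last by ring.
    apply: le_trans (ler_normB _ _) _; lra_from Hl Ha.
  - move=> x; rewrite /= in_itv /= => xj xd; apply: diff0 => //.
    have [xl|[xr|]] := far j x jn'; [by left|by right|].
    by rewrite ler_norml => xm; case/negP: xd; lra_from xm.
apply: (le_trans LpE).
have := HM s (Iset_left n z j) (Iset_right n z j) (z j) (d j) (P j.-1) (A j) (Li j).2 dj.
have Isl : Iset_left n z j <= z j - d j.
  case: j jn' {jn jn2 lK lE lpos lB AB B B0 CB0 dj mod0 s_left s_right diff0 LpE} g1 {g2} => // j /andP[_ jn] g1.
  by rewrite Iset_leftS 1?ltnW//; lra_from g1.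
have Isr : z j + d j <= Iset_right n z j by rewrite Iset_rightE//; lra_from g2.
have j1n : (j.-1 < n)%N by rewrite (leq_ltn_trans (leq_pred _)).
have [sj1 _] := HP _ j1n; have [sj _] := HP _ jn2.
have sA : (size (A j) <= D.+1)%N.
  by rewrite (leq_trans (size_polyD _ _))// geq_max sj size_polyN.
move=> /(_ Isl Isr sj1 sA) H.
have {}H := H _ _ p p0.
have {}H : ((mu * B * Lp_scale p (kap * d j))%:E <=
    modulus_smoothness_itv D.+1 s (Iset_left n z j) (Iset_right n z j) p)%E.
  apply: H => x /andP[x1 x2].
    by apply: s_left => //; lra_from x1 g1 dj.
  by apply: s_right => //; lra_from x2 g2 dj.
apply: (@le_trans _ _ ((2 * C / mu * Lp_scale p (2 / kap))%:E *
    (mu * B * Lp_scale p (kap * d j))%:E)%E); last first.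
  by apply: lee_wpmul2l => //; rewrite lee_fin ltW.
rewrite -EFinM lee_fin (_ : z j + d j - _ = 2 / kap * (kap * d j)); last first.
  by field; rewrite gt_eqF.
rewrite (Lp_scaleM _ (d := 2 / kap)); last 2 first.
- by rewrite divr_ge0// ltW.
- by rewrite mulr_ge0 ?(ltW kap0) ?(ltW dj).
rewrite le_eqVlt; apply/orP; left; apply/eqP; field.
by rewrite gt_eqF.
Qed.
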